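(* Let $k$ be a field of characteristic $0$ and $A$ a commutative $k$-algebra. The Thom–Sullivan functor $X\mapsto\Omega(X)$ from cosimplicial $A$-modules to complexes of $A$-modules is exact.
   Context: $\Omega_p=k[t_0,\dots,t_p,dt_0,\dots,dt_p]/(\sum t_i-1,\sum dt_i)$ is the commutative dg algebra of polynomial differential forms on the $p$-simplex ($\deg dt_i=1$, $d(t_i)=dt_i$); these form a simplicial dg algebra in $p$. For a cosimplicial $A$-module $X=\{X^p\}$, $\Omega^n(X)$ is the $A$-module of all families $\{x_p\in\Omega^n_p\otimes_kX^p\}_{p\ge0}$ such that $(\alpha^*\otimes1)(x_q)=(1\otimes\alpha_* )(x_p)$ in $\Omega_p^n\otimes_kX^q$ for every nondecreasing map $\alpha:[p]\to[q]$. The complex $\Omega(X)$ has terms $\Omega^n(X)$, $n\ge0$, and differential induced by the de Rham differential. *)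

(* Defs.v *)
From HB Require Import structures.
From mathcomp Require Import all_boot all_order all_algebra.
From mathcomp Require Import boolp zify.
From mathcomp Require Import mpoly.

Set Implicit Arguments.
Unset Strict Implicit.
Unset Printing Implicit Defensive.

Import GRing.Theory.
Local Open Scope ring_scope.

Definition inversions n (I J : {set 'I_n}) : nat :=
  (\sum_(i in I) \sum_(j in J) (j < i))%N.

(* dt_I dt_J = shuffle_sign I J * dt_(I :|: J), where dt_I is the product of
   the dt_i, i in I, in increasing order. *)
Definition shuffle_sign (R : nzRingType) n (I J : {set 'I_n}) : R :=
  if [disjoint I & J] then (-1) ^+ inversions I J else 0.

Section Signs.
Variables (R : comNzRingType) (n : nat).
Implicit Types I J K : {set 'I_n}.
Local Notation sgn := (@shuffle_sign R n).

Lemma big_disjointU (F : 'I_n -> nat) I J : [disjoint I & J] ->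
  (\sum_(i in I :|: J) F i = \sum_(i in I) F i + \sum_(i in J) F i)%N.
Proof.
by move=> dIJ; rewrite -bigU //=; apply: eq_bigl => i; rewrite !inE.
Qed.

Lemma shuffle_sign0l J : sgn set0 J = 1.
Proof. by rewrite /shuffle_sign -setI_eq0 set0I eqxx /inversions big_set0. Qed.

Lemma shuffle_sign0r I : sgn I set0 = 1.
Proof.
rewrite /shuffle_sign -setI_eq0 setI0 eqxx /inversions big1 // => i _.
by rewrite big_set0.
Qed.

Lemma shuffle_sign_cocycle I J K :
  sgn I J * sgn (I :|: J) K = sgn J K * sgn I (J :|: K).
Proof.
rewrite /shuffle_sign -!setI_eq0 setIUl setIUr !setU_eq0.
case: (boolP (I :&: J == set0)) => dIJ /=; last by rewrite mul0r mulr0.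
case: (boolP (J :&: K == set0)) => dJK /=; last by rewrite andbF mul0r mulr0.
rewrite andbT; case: (boolP (I :&: K == set0)) => dIK; last by rewrite !mulr0.
rewrite !setI_eq0 in dIJ dJK dIK; rewrite -!exprD; congr (_ ^+ _).
rewrite /inversions big_disjointU //.
rewrite (_ : \sum_(i in I) \sum_(j in J :|: K) (j < i) =
  \sum_(i in I) \sum_(j in J) (j < i) + \sum_(i in I) \sum_(j in K) (j < i))%N.
  lia.
by rewrite -big_split /=; apply: eq_bigr => i _; rewrite big_disjointU.
Qed.

Lemma shuffle_sign_sq I J : [disjoint I & J] -> sgn I J * sgn I J = 1.
Proof. by move=> dIJ; rewrite /shuffle_sign dIJ -expr2 sqrr_sign. Qed.

End Signs.

(* The free graded-commutative k-algebra k[t_0, .., t_p, dt_0, .., dt_p]: the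
   element a stands for the sum over I of (a I) dt_I. *)
Definition gform (k : fieldType) (p : nat) :=
  {ffun {set 'I_p.+1} -> {mpoly k[p.+1]}}.

HB.instance Definition _ k p := GRing.Lmodule.on (gform k p).

Section GForm.
Variables (k : fieldType) (p : nat).
Local Notation E := (gform k p).
Local Notation P := {mpoly k[p.+1]}.
Implicit Types (a b c : E) (f g : P) (I J K : {set 'I_p.+1}).

Definition gmono I f : E := [ffun K => if K == I then f else 0].

Fact gmono_is_linear I : linear (gmono I).
Proof.
move=> c f g; apply/ffunP => K; rewrite !ffunE.
by case: eqP; rewrite ?scaler0 ?addr0.
Qed.
HB.instance Definition _ I :=
  GRing.isLinear.Build k P E *:%R (gmono I) (gmono_is_linear I).

Lemma gmonoE a : a = \sum_I gmono I (a I).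
Proof.
apply/ffunP => K; rewrite sum_ffunE (bigD1 K) //= ffunE eqxx big1 ?addr0 //.
by move=> I nIK; rewrite ffunE eq_sym (negPf nIK).
Qed.

Definition gmul a b : E :=
  \sum_I \sum_J gmono (I :|: J) (shuffle_sign k I J *: (a I * b J)).

Fact gmulDl : left_distributive gmul +%R.
Proof.
move=> a b c; rewrite -big_split; apply: eq_bigr => I _ /=.
rewrite -big_split; apply: eq_bigr => J _ /=.
by rewrite ffunE mulrDl scalerDr raddfD.
Qed.

Fact gmulDr : right_distributive gmul +%R.
Proof.
move=> c a b; rewrite -big_split; apply: eq_bigr => I _ /=.
rewrite -big_split; apply: eq_bigr => J _ /=.
by rewrite ffunE mulrDr scalerDr raddfD.
Qed.

Lemma gmul0r a : gmul 0 a = 0.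
Proof. by apply: (addrI (gmul 0 a)); rewrite -gmulDl !addr0. Qed.

Lemma gmulr0 a : gmul a 0 = 0.
Proof. by apply: (addrI (gmul a 0)); rewrite -gmulDr !addr0. Qed.

Lemma gmul_suml (T : finType) (F : T -> E) b :
  gmul (\sum_i F i) b = \sum_i gmul (F i) b.
Proof.
exact: (big_morph (gmul^~ b) (fun x y => gmulDl x y b) (gmul0r b)).
Qed.

Lemma gmul_sumr (T : finType) (F : T -> E) b :
  gmul b (\sum_i F i) = \sum_i gmul b (F i).
Proof.
exact: (big_morph (gmul b) (gmulDr b) (gmulr0 b)).
Qed.

Lemma gmul_mono f g I J :
  gmul (gmono I f) (gmono J g)
  = gmono (I :|: J) (shuffle_sign k I J *: (f * g)).
Proof.
rewrite /gmul (bigD1 I) //= (bigD1 J) //= !ffunE !eqxx big1 ?addr0 => [|K nK].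
  rewrite big1 ?addr0 // => K nK; apply: big1 => L _.
  by rewrite !ffunE (negPf nK) mul0r scaler0 raddf0.
by rewrite !ffunE (negPf nK) mulr0 scaler0 raddf0.
Qed.

Fact gmulA : associative gmul.
Proof.
move=> a b c; rewrite [a]gmonoE !gmul_suml; apply: eq_bigr => I _.
rewrite [b]gmonoE gmul_suml !gmul_sumr gmul_suml; apply: eq_bigr => J _.
rewrite [c]gmonoE !gmul_sumr; apply: eq_bigr => K _.
rewrite !gmul_mono setUA -scalerAr -scalerAl !scalerA mulrA.
by rewrite mulrC -shuffle_sign_cocycle mulrC.
Qed.

Definition gone : E := gmono set0 1.

Fact gmul1r : left_id gone gmul.
Proof.
move=> a; rewrite [a]gmonoE gmul_sumr; apply: eq_bigr => I _.
by rewrite gmul_mono set0U shuffle_sign0l scale1r mul1r.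
Qed.

Fact gmulr1 : right_id gone gmul.
Proof.
move=> a; rewrite [a]gmonoE gmul_suml; apply: eq_bigr => I _.
by rewrite gmul_mono setU0 shuffle_sign0r scale1r mulr1.
Qed.

Fact gone_neq0 : gone != 0.
Proof. by apply/eqP => /ffunP/(_ set0)/eqP; rewrite !ffunE eqxx oner_eq0. Qed.

HB.instance Definition _ := GRing.Zmodule_isNzRing.Build E
  gmulA gmul1r gmulr1 gmulDl gmulDr gone_neq0.

Fact gscaleAl (x : k) a b : x *: (a * b) = (x *: a) * b.
Proof.
rewrite scaler_sumr; apply: eq_bigr => I _; rewrite scaler_sumr.
apply: eq_bigr => J _; rewrite !ffunE -linearZ_LR /= -scalerAl !scalerA.
by rewrite mulrC.
Qed.
HB.instance Definition _ := GRing.Lmodule_isLalgebra.Build k E gscaleAl.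

Fact gscaleAr (x : k) a b : x *: (a * b) = a * (x *: b).
Proof.
rewrite scaler_sumr; apply: eq_bigr => I _; rewrite scaler_sumr.
apply: eq_bigr => J _; rewrite !ffunE -linearZ_LR /= -scalerAr !scalerA.
by rewrite mulrC.
Qed.
HB.instance Definition _ := GRing.Lalgebra_isAlgebra.Build k E gscaleAr.

Lemma mul_gmono f g I J :
  gmono I f * gmono J g = gmono (I :|: J) (shuffle_sign k I J *: (f * g)).
Proof. exact: gmul_mono. Qed.

(* The polynomial f as an element of degree 0, and the generators. *)
Definition gpoly f : E := gmono set0 f.
Definition gt (i : 'I_p.+1) : E := gpoly 'X_i.
Definition gdt (i : 'I_p.+1) : E := gmono [set i] 1.

HB.instance Definition _ := GRing.isLinear.Build k P E *:%R gpoly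
  (gmono_is_linear set0).

Fact gpoly_is_monoid : monoid_morphism gpoly.
Proof.
split=> // f g.
by rewrite mul_gmono setU0 shuffle_sign0l scale1r.
Qed.
HB.instance Definition _ := GRing.isMonoidMorphism.Build P E gpoly
  gpoly_is_monoid.

Lemma gpolyC f a : gpoly f * a = a * gpoly f.
Proof.
rewrite [a]gmonoE mulr_sumr mulr_suml; apply: eq_bigr => I _.
by rewrite !mul_gmono setU0 set0U shuffle_sign0l shuffle_sign0r mulrC.
Qed.

Lemma gpoly_mul_gmono f g I : gpoly f * gmono I g = gmono I (f * g).
Proof. by rewrite mul_gmono set0U shuffle_sign0l scale1r. Qed.

End GForm.

Section Odd.
Variables (k : fieldType) (R : algType k) (n : nat) (x : 'I_n -> R).
Hypothesis xC : forall i j, x i * x j = - (x j * x i).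
Hypothesis xx : forall i, x i * x i = 0.
Implicit Types I J : {set 'I_n}.
Local Notation sgn := (@shuffle_sign k n).

Lemma odd_comm_prod (s : seq 'I_n) J i :
  x i * \prod_(j <- s | j \in J) x j
  = (-1) ^+ (\sum_(j <- s | j \in J) 1) *: (\prod_(j <- s | j \in J) x j * x i).
Proof.
elim: s => [|j s IH]; first by rewrite !big_nil mulr1 mul1r scale1r.
rewrite !big_cons; case: ifP => // _.
rewrite mulrA xC mulNr -[x j * x i * _]mulrA IH -scalerAr exprD mulN1r.
by rewrite scaleNr mulrA.
Qed.

Lemma odd_mul_prod i J :
  x i * \prod_(j in J) x j
  = sgn [set i] J *: \prod_(j in i |: J) x j.
Proof.
have ii : i \in index_enum 'I_n by rewrite mem_index_enum.
have : uniq (index_enum 'I_n) by rewrite index_enum_uniq.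
have : sorted ltn [seq val j | j <- index_enum 'I_n].
  by rewrite /index_enum unlock /= -enumT val_enum_ord iota_ltn_sorted.
rewrite /shuffle_sign disjoints1 /inversions big_set1.
case/splitPr: ii => s1 s2 ss us.
have {}us : (i \notin s1) && (i \notin s2).
  move: us; rewrite cat_uniq /= negb_or => /and3P[_ /andP[-> _]].
  by case/andP=> ->.
have [ns1 ns2] := andP us.
have l1 j : j \in s1 -> (j < i)%N.
  move=> js; move: ss; rewrite map_cat /= (sorted_pairwise ltn_trans).
  rewrite pairwise_cat allrel_consr => /andP[/andP[/allP h _] _].
  by apply: h; apply/mapP; exists j.
have l2 j : j \in s2 -> (j < i)%N = false.
  move=> js; move: ss; rewrite map_cat /= (sorted_pairwise ltn_trans).
  rewrite pairwise_cat /= => /and3P[_ _ /andP[/allP h _]].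
  by apply/negbTE; rewrite -leqNgt ltnW // h //; apply/mapP; exists j.
rewrite !big_cat !big_cons /= setU11.
have -> : (\sum_(j <- s1 | j \in J) (j < i) = \sum_(j <- s1 | j \in J) 1)%N.
  by rewrite big_seq_cond [in RHS]big_seq_cond; apply: eq_bigr => j /andP[/l1->].
have -> : (\sum_(j <- s2 | j \in J) (j < i) = 0)%N.
  by rewrite big_seq_cond big1 // => j /andP[/l2->].
have U s' : i \notin s' ->
    \prod_(j <- s' | j \in i |: J) x j = \prod_(j <- s' | j \in J) x j.
  move=> ns; rewrite big_seq_cond [in RHS]big_seq_cond; apply: eq_bigl => j.
  by rewrite !inE; case: eqVneq => [->|//]; rewrite (negPf ns).
rewrite !U // ltnn mulrA odd_comm_prod -scalerAl.
case: ifP => iJ /=; last by rewrite addn0 mulrA.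
by rewrite -!mulrA (mulrA (x i)) xx mul0r mulr0 scaler0 scale0r.
Qed.

Lemma odd_prod_mul I J :
  \prod_(i in I) x i * \prod_(j in J) x j = sgn I J *: \prod_(i in I :|: J) x i.
Proof.
have [m] := ubnP #|I|; elim: m I => // m IH I.
case: (set_0Vmem I) => [->|[i iI]] cI.
  by rewrite big_set0 mul1r set0U shuffle_sign0l scale1r.
have dI : [disjoint [set i] & I :\ i] by rewrite disjoints1 !inE eqxx.
have := odd_mul_prod i (I :\ i); rewrite setD1K // => h.
have -> : \prod_(j in I) x j = sgn [set i] (I :\ i) *: (x i * \prod_(j in I :\ i) x j).
  by rewrite h scalerA shuffle_sign_sq // scale1r.
rewrite -scalerAl -mulrA IH; last by rewrite (cardsD1 i) iI in cI.
rewrite -scalerAr odd_mul_prod !scalerA setUA setD1K // -mulrA.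
by rewrite -shuffle_sign_cocycle setD1K // mulrA shuffle_sign_sq // mul1r.
Qed.
End Odd.

Section Generators.
Variables (k : fieldType) (p : nat).
Local Notation E := (gform k p).
Local Notation P := {mpoly k[p.+1]}.
Implicit Types (a b : E) (f g : P) (I J : {set 'I_p.+1}) (i j : 'I_p.+1).
Local Notation dt := (@gdt k p).

Lemma gdt_sq i : dt i * dt i = 0.
Proof.
by rewrite mul_gmono /shuffle_sign disjoints1 inE eqxx scale0r raddf0.
Qed.

Lemma gdt_anti i j : dt i * dt j = - (dt j * dt i).
Proof.
have [->|nij] := eqVneq i j; first by rewrite !gdt_sq oppr0.
rewrite !mul_gmono setUC -raddfN -scaleNr /shuffle_sign !disjoints1 !inE.
rewrite [j == i]eq_sym (negPf nij) /= /inversions !big_set1.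
have [ij|ji] := ltnP i j.
  by rewrite ltnNge ltnW //= expr0 expr1 ?opprK.
rewrite ltn_neqAle eq_sym (_ : (i == j :> nat) = false) ?ji ?expr1 //.
by apply/negbTE; apply: contra nij => /eqP/val_inj->.
Qed.

Lemma gmono_prod f I : gmono I f = gpoly f * \prod_(i in I) dt i.
Proof.
suff -> : \prod_(i in I) dt i = gmono I 1 by rewrite gpoly_mul_gmono mulr1.
have [m] := ubnP #|I|; elim: m I => // m IH I.
case: (set_0Vmem I) => [->|[i iI]] cI; first by rewrite big_set0.
have dI : [disjoint [set i] & I :\ i] by rewrite disjoints1 !inE eqxx.
have := odd_mul_prod gdt_anti gdt_sq i (I :\ i); rewrite setD1K // => h.
rewrite -[LHS]scale1r -(shuffle_sign_sq k dI) -scalerA -h IH; last first.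
  by rewrite (cardsD1 i) iI in cI.
by rewrite mul_gmono setD1K // mulr1 linearZ /= scalerA shuffle_sign_sq // scale1r.
Qed.

Lemma gform_ind (Q : E -> Prop) :
  (forall a b, Q a -> Q b -> Q (a + b)) -> (forall f, Q (gpoly f)) ->
  (forall i a, Q a -> Q (dt i * a)) -> (forall f a, Q a -> Q (gpoly f * a)) ->
  forall a, Q a.
Proof.
move=> QD Qp Qd QM a; rewrite [a]gmonoE; apply: (big_ind Q) => //.
  by have := Qp 0; rewrite raddf0.
move=> I _; rewrite gmono_prod; apply: QM.
elim/big_rec: _ => [|i x _]; first by have := Qp 1; rewrite rmorph1.
exact: Qd.
Qed.

End Generators.
Lemma mderivXU (R : nzRingType) n (i j : 'I_n) :
  ('X_j : {mpoly R[n]})^`M(i) = (i == j)%:R.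
Proof.
rewrite mderivX mnm1E eq_sym; case: eqVneq => [->|_]; last by rewrite scale0r.
rewrite scale1r (_ : (_ - _)%MM = 0%MM) ?mpolyX0 //.
by apply/mnmP => l; rewrite !mnmE subnn.
Qed.

Lemma mpoly_gen_ind (R : nzRingType) n (Q : {mpoly R[n]} -> Prop) :
  (forall f g, Q f -> Q g -> Q (f + g)) -> (forall f g, Q f -> Q g -> Q (f * g)) ->
  (forall c, Q c%:MP) -> (forall i, Q 'X_i) -> forall f, Q f.
Proof.
move=> QD QM QC QX; elim/mpolyind => [|c m f _ _ Qf].
  by rewrite -mpolyC0; apply: QC.
apply: QD Qf; rewrite -mul_mpolyC; apply: (QM _ _ (QC c)); rewrite mpolyXE_id.
have Q1 : Q 1 by rewrite -mpolyC1; apply: QC.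
apply: (big_ind Q Q1 QM) => i _; elim: (m i) => [|d IH]; first by rewrite expr0.
by rewrite exprS; apply: QM.
Qed.

Section DeRham.
Variables (k : fieldType) (p : nat).
Local Notation E := (gform k p).
Implicit Types (a b : E) (i j : 'I_p.+1).
Local Notation dt := (@gdt k p).

Definition gpartial i a : E := [ffun I => (a I)^`M(i)].

Fact gpartial_is_linear i : linear (gpartial i).
Proof. by move=> x a b; apply/ffunP => I; rewrite !ffunE mderivD mderivZ. Qed.
HB.instance Definition _ i :=
  GRing.isLinear.Build k E E *:%R (gpartial i) (gpartial_is_linear i).

Lemma gpartial_mono i I f : gpartial i (gmono I f) = gmono I f^`M(i).
Proof. by apply/ffunP => J; rewrite !ffunE; case: eqP; rewrite ?mderiv0. Qed.

Lemma gpartialM i a b :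
  gpartial i (a * b) = gpartial i a * b + a * gpartial i b.
Proof.
rewrite [a]gmonoE [b]gmonoE !mulr_suml !linear_sum !mulr_suml -big_split /=.
apply: eq_bigr => I _; rewrite !mulr_sumr linear_sum -big_split /=.
apply: eq_bigr => J _; rewrite !gpartial_mono !mul_gmono gpartial_mono -raddfD.
by rewrite mderivZ mderivM scalerDr.
Qed.

Lemma gpartialC i j a : gpartial i (gpartial j a) = gpartial j (gpartial i a).
Proof. by apply/ffunP => I; rewrite !ffunE mderiv_comm. Qed.

Lemma gpartial_gdt i j : gpartial i (dt j) = 0.
Proof. by rewrite gpartial_mono -mpolyC1 mderivC raddf0. Qed.

(* The de Rham differential: d(f dt_I) is the sum of the (df/dt_i) dt_i dt_I. *)
Definition gd a : E := \sum_i dt i * gpartial i a.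

Fact gd_is_linear : linear gd.
Proof.
move=> x a b; rewrite scaler_sumr -big_split; apply: eq_bigr => i _ /=.
by rewrite linearP mulrDr scalerAr.
Qed.
HB.instance Definition _ := GRing.isLinear.Build k E E *:%R gd gd_is_linear.

Lemma gd_gt i : gd (gt k i) = dt i.
Proof.
rewrite /gd (bigD1 i) //= big1 => [|j nji]; rewrite gpartial_mono mderivXU.
  by rewrite eqxx addr0 [gmono _ _](rmorph1 (@gpoly k p)) mulr1.
by rewrite (negPf nji) raddf0 mulr0.
Qed.

Lemma anti_sum0 n (F : 'I_n -> 'I_n -> E) :
  (forall i : 'I_n, F i i = 0) -> (forall i j : 'I_n, F i j = - F j i) ->
  \sum_(i < n) \sum_(j < n) F i j = 0.
Proof.
elim: n F => [|n IH] F F0 FN; first by rewrite big_ord0.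
rewrite big_ord_recl big_ord_recl F0 add0r.
under [X in _ + X]eq_bigr do rewrite big_ord_recl.
rewrite big_split /= addrA -big_split /= big1 ?add0r => [|i _].
  by apply: IH => *; [exact: F0|exact: FN].
by rewrite FN addNr.
Qed.

Lemma gd_gd a : gd (gd a) = 0.
Proof.
rewrite /gd; under eq_bigr do rewrite linear_sum mulr_sumr /=.
apply: anti_sum0 => [i|i j]; rewrite gpartialM gpartial_gdt mul0r add0r mulrA.
  by rewrite gdt_sq mul0r.
by rewrite gpartialM gpartial_gdt mul0r add0r mulrA gdt_anti mulNr gpartialC.
Qed.

(* The two relations defining Omega_p. *)
Definition gsigma : E := \sum_i gt k i - 1.
Definition gtau : E := \sum_i dt i.

(* The ideal they generate; left multiples suffice as gsigma is central and
   gtau commutes with homogeneous elements up to sign. *)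
Definition gideal : {pred E} :=
  fun w => `[< exists a b, w = a * gsigma + b * gtau >].

Fact gideal_submod_closed : submod_closed gideal.
Proof.
split; first by apply/asboolP; exists 0, 0; rewrite !mul0r addr0.
move=> x _ _ /asboolP[a [b ->]] /asboolP[a' [b' ->]]; apply/asboolP.
exists (x *: a + a'), (x *: b + b').
by rewrite scalerDr !mulrDl !scalerAl addrACA.
Qed.
HB.instance Definition _ := GRing.isSubmodClosed.Build k E gideal
  gideal_submod_closed.

Lemma gideal_mull a w : w \in gideal -> a * w \in gideal.
Proof.
move=> /asboolP[b [c ->]]; apply/asboolP; exists (a * b), (a * c).
by rewrite mulrDr !mulrA.
Qed.

Lemma gsigma_in : gsigma \in gideal.
Proof. by apply/asboolP; exists 1, 0; rewrite mul1r mul0r addr0. Qed.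

Lemma gtau_in : gtau \in gideal.
Proof. by apply/asboolP; exists 0, 1; rewrite mul1r mul0r add0r. Qed.

Lemma gsigmaC a : gsigma * a = a * gsigma.
Proof.
rewrite mulrBl mulrBr mul1r mulr1 mulr_suml mulr_sumr; congr (_ - _).
by apply: eq_bigr => i _; rewrite gpolyC.
Qed.

Lemma gtauC a : exists b, gtau * a = b * gtau.
Proof.
elim/gform_ind: a => [a a' [b eb] [b' eb']|f|i a [b e]|f a [b e]].
- by exists (b + b'); rewrite mulrDr mulrDl eb eb'.
- by exists (gpoly f); rewrite gpolyC.
- exists (- (dt i * b)); rewrite mulrA (_ : gtau * dt i = - (dt i * gtau)).
    by rewrite mulNr -mulrA e mulrA mulNr.
  rewrite mulr_suml mulr_sumr -sumrN.
  by apply: eq_bigr => j _; rewrite gdt_anti.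
- by exists (gpoly f * b); rewrite mulrA -gpolyC -mulrA e mulrA.
Qed.

Lemma gideal_mulr a w : w \in gideal -> w * a \in gideal.
Proof.
move=> /asboolP[b [c ->]]; rewrite mulrDl -!mulrA gsigmaC.
have [a' ->] := gtauC a.
by apply/asboolP; exists (b * a), (c * a'); rewrite !mulrA.
Qed.

Lemma gpartial_gtau i : gpartial i gtau = 0.
Proof. by rewrite linear_sum big1 // => j _ /=; rewrite gpartial_gdt. Qed.

Lemma gpartial_gsigma i : gpartial i gsigma = 1.
Proof.
rewrite linearB linear_sum /= (bigD1 i) //= big1 => [|j nji]; last first.
  by rewrite gpartial_mono mderivXU eq_sym (negPf nji) raddf0.
rewrite gpartial_mono mderivXU eqxx -(rmorph1 (@gpoly k p)) gpartial_mono.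
by rewrite -mpolyC1 mderivC raddf0 addr0 subr0.
Qed.

Lemma gd_ideal w : w \in gideal -> gd w \in gideal.
Proof.
move=> /asboolP[a [b ->]]; rewrite linearD /=.
have -> : gd (a * gsigma) = gd a * gsigma + gtau * a.
  rewrite /gd /gtau !mulr_suml -big_split; apply: eq_bigr => i _ /=.
  by rewrite gpartialM gpartial_gsigma mulr1 mulrDr mulrA.
have -> : gd (b * gtau) = gd b * gtau.
  rewrite /gd !mulr_suml; apply: eq_bigr => i _ /=.
  by rewrite gpartialM gpartial_gtau mulr0 addr0 mulrA.
rewrite !rpredD //; first exact: gideal_mull gsigma_in.
  exact: gideal_mulr gtau_in.
exact: gideal_mull gtau_in.
Qed.

Definition ghomog n : {pred E} :=
  fun a => [forall I : {set 'I_p.+1}, (#|I| == n) || (a I == 0)].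

Lemma ghomogP n a :
  reflect (forall I : {set 'I_p.+1}, #|I| != n -> a I = 0) (a \in ghomog n).
Proof.
apply: (iffP forallP) => h I.
  by move=> /negPf nI; have := h I; rewrite nI => /eqP.
by have [//|/h->] := eqVneq #|I| n; rewrite eqxx.
Qed.

Fact ghomog_submod_closed n : submod_closed (ghomog n).
Proof.
split; first by apply/ghomogP => I _; rewrite ffunE.
move=> x a b /ghomogP ha /ghomogP hb; apply/ghomogP => I nI.
by rewrite !ffunE ha // hb // scaler0 addr0.
Qed.
HB.instance Definition _ n := GRing.isSubmodClosed.Build k E (ghomog n)
  (ghomog_submod_closed n).

Lemma gmono_homog I f : gmono I f \in ghomog #|I|.
Proof.
apply/ghomogP => J nJ; rewrite ffunE.
by case: (eqVneq J I) nJ => [->|//]; rewrite eqxx.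
Qed.

Lemma ghomogM m n a b :
  a \in ghomog m -> b \in ghomog n -> a * b \in ghomog (m + n)%N.
Proof.
move=> /ghomogP ha /ghomogP hb; apply: rpred_sum => I _; apply: rpred_sum => J _.
have [cI|/ha->] := eqVneq #|I| m; last by rewrite mul0r scaler0 raddf0 rpred0.
have [cJ|/hb->] := eqVneq #|J| n; last by rewrite mulr0 scaler0 raddf0 rpred0.
rewrite /shuffle_sign; case: ifPn => dIJ; last by rewrite scale0r raddf0 rpred0.
rewrite -cI -cJ (_ : #|I| + #|J| = #|I :|: J|)%N ?gmono_homog //.
by rewrite cardsU; move: dIJ; rewrite -setI_eq0 => /eqP->; rewrite cards0 subn0.
Qed.

Lemma gdt_homog i : dt i \in ghomog 1.
Proof. by have := gmono_homog [set i] 1; rewrite cards1. Qed.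

Lemma gpoly_homog f : gpoly f \in ghomog 0.
Proof. by have := gmono_homog set0 f; rewrite cards0. Qed.

Lemma gd_homog n a : a \in ghomog n -> gd a \in ghomog n.+1.
Proof.
move=> /ghomogP ha; apply: rpred_sum => i _; rewrite -add1n.
apply: ghomogM (gdt_homog i) _.
by apply/ghomogP => I nI; rewrite ffunE ha // mderiv0.
Qed.

End DeRham.

Arguments gideal : clear implicits.
Arguments ghomog : clear implicits.

Section Pullback.
Variables (k : fieldType) (p q : nat) (alpha : 'I_p.+1 -> 'I_q.+1).
Local Notation E := (gform k).

(* alpha^* is the algebra morphism with t_i |-> \sum_(alpha j = i) t_j and
   dt_i |-> \sum_(alpha j = i) dt_j. *)
Definition gpull_poly (f : {mpoly k[q.+1]}) : {mpoly k[p.+1]} :=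
  f \mPo [tuple \sum_(j | alpha j == i) 'X_j | i < q.+1].

HB.instance Definition _ := GRing.RMorphism.copy gpull_poly
  (comp_mpoly [tuple \sum_(j | alpha j == i) 'X_j | i < q.+1]).
HB.instance Definition _ := GRing.Linear.copy gpull_poly
  (comp_mpoly [tuple \sum_(j | alpha j == i) 'X_j | i < q.+1]).

Definition gpull_dt (i : 'I_q.+1) : E p := \sum_(j | alpha j == i) gdt k j.

Definition gpull (a : E q) : E p :=
  \sum_I gpoly (gpull_poly (a I)) * \prod_(i in I) gpull_dt i.

Fact gpull_is_linear : linear gpull.
Proof.
move=> x a b; rewrite scaler_sumr -big_split; apply: eq_bigr => I _ /=.
by rewrite !ffunE !linearP mulrDl scalerAl.
Qed.
HB.instance Definition _ :=
  GRing.isLinear.Build k (E q) (E p) *:%R gpull gpull_is_linear.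

Lemma gpull_mono I f :
  gpull (gmono I f) = gpoly (gpull_poly f) * \prod_(i in I) gpull_dt i.
Proof.
rewrite /gpull (bigD1 I) //= ffunE eqxx [X in _ + X]big1 ?addr0 // => J nJ.
by rewrite ffunE (negPf nJ) !raddf0 mul0r.
Qed.

Lemma gpull_dt_anti i j : gpull_dt i * gpull_dt j = - (gpull_dt j * gpull_dt i).
Proof.
rewrite mulr_suml [in RHS]mulr_sumr -sumrN; apply: eq_bigr => a _.
rewrite mulr_sumr mulr_suml -sumrN; apply: eq_bigr => b _.
by rewrite gdt_anti.
Qed.

Lemma gpull_dt_sq i : gpull_dt i * gpull_dt i = 0.
Proof.
rewrite /gpull_dt; set Q := fun x : E p => x * x = 0 /\
  forall j, x * gdt k j = - (gdt k j * x).
suff [] : Q (\sum_(j | alpha j == i) gdt k j) by [].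
apply: (big_rec Q); first by split=> [|j]; rewrite !(mul0r, mulr0, oppr0).
move=> j x _ [xx xdt]; split=> [|l].
  by rewrite mulrDl !mulrDr xx gdt_sq xdt add0r addr0 subrr.
by rewrite mulrDl mulrDr xdt gdt_anti opprD.
Qed.

Fact gpull_is_monoid : monoid_morphism gpull.
Proof.
split; first by rewrite gpull_mono rmorph1 big_set0 mulr1 rmorph1.
move=> a b; rewrite [a]gmonoE mulr_suml !linear_sum mulr_suml /=.
apply: eq_bigr => I _; rewrite [b]gmonoE mulr_sumr !linear_sum mulr_sumr /=.
apply: eq_bigr => J _; rewrite mul_gmono !gpull_mono linearZ rmorphM linearZ rmorphM /=.
set F := gpoly _; set G := gpoly _; rewrite [RHS]mulrA -(mulrA F).
rewrite -[\prod_(i in I) _ * G]gpolyC.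
rewrite (mulrA F G) -[RHS]mulrA (odd_prod_mul gpull_dt_anti gpull_dt_sq) -scalerAr.
by rewrite -scalerAl.
Qed.
HB.instance Definition _ :=
  GRing.isMonoidMorphism.Build (E q) (E p) gpull gpull_is_monoid.

Lemma gpull_gpoly f : gpull (gpoly f) = gpoly (gpull_poly f).
Proof. by rewrite gpull_mono big_set0 mulr1. Qed.

Lemma gpull_gdt i : gpull (gdt k i) = gpull_dt i.
Proof. by rewrite gpull_mono !rmorph1 big_set1 mul1r. Qed.

Lemma gpull_gt i : gpull (gt k i) = \sum_(j | alpha j == i) gt k j.
Proof.
rewrite gpull_gpoly /gpull_poly comp_mpolyXU -tnth_nth tnth_mktuple.
by rewrite linear_sum.
Qed.

Lemma gpull_gsigma : gpull (gsigma k q) = gsigma k p.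
Proof.
rewrite /gsigma rmorphB rmorph1 raddf_sum /=; congr (_ - _).
rewrite [RHS](partition_big alpha predT) //=.
by apply: eq_bigr => i _; rewrite gpull_gt.
Qed.

Lemma gpull_gtau : gpull (gtau k q) = gtau k p.
Proof.
rewrite /gtau linear_sum /= [RHS](partition_big alpha predT) //=.
by apply: eq_bigr => i _; rewrite gpull_gdt.
Qed.

Lemma gpull_ideal w : w \in gideal k q -> gpull w \in gideal k p.
Proof.
move=> /asboolP[a [b ->]]; rewrite rmorphD !rmorphM /= gpull_gsigma gpull_gtau.
by apply/asboolP; exists (gpull a), (gpull b).
Qed.

Lemma gpull_homog n a : a \in ghomog k q n -> gpull a \in ghomog k p n.
Proof.
move=> /ghomogP ha; apply: rpred_sum => I _.
have [<-|/ha->] := eqVneq #|I| n; last by rewrite !raddf0 mul0r rpred0.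
rewrite -[#|I|]add0n; apply: ghomogM (gpoly_homog _) _.
rewrite -sum1_card; elim/big_rec2: _ => [|i m x _ hx].
  by rewrite -(rmorph1 (@gpoly k p)) gpoly_homog.
by apply: ghomogM hx; apply: rpred_sum => j _; apply: gdt_homog.
Qed.

Lemma gpull_poly_deriv j f :
  (gpull_poly f)^`M(j) = gpull_poly f^`M(alpha j).
Proof.
elim/mpoly_gen_ind: f => [f g ef eg|f g ef eg|c|i].
- by rewrite rmorphD /= !mderivD rmorphD /= ef eg.
- by rewrite rmorphM /= !mderivM rmorphD !rmorphM /= ef eg.
- by rewrite /gpull_poly comp_mpolyC !mderivC comp_mpoly0.
rewrite {1}/gpull_poly comp_mpolyXU -tnth_nth tnth_mktuple linear_sum /=.
rewrite mderivXU rmorph_nat big_mkcond (bigD1 j) //= mderivXU eqxx big1.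
  by rewrite addr0; case: eqP.
by move=> l nlj; rewrite mderivXU [j == l]eq_sym (negPf nlj) if_same.
Qed.

Lemma gpull_gd a : gpull (gd a) = gd (gpull a).
Proof.
rewrite [a]gmonoE (linear_sum (@gd k q)) !(linear_sum gpull).
rewrite (linear_sum (@gd k p)); apply: eq_bigr => I _ /=.
rewrite {1}/gd linear_sum gpull_mono /gd.
rewrite [RHS](partition_big alpha predT) //=; apply: eq_bigr => i _.
rewrite rmorphM /= gpull_gdt gpartial_mono gpull_mono mulr_suml.
apply: eq_bigr => j /eqP ij; congr (_ * _).
rewrite gpartialM gpartial_mono gpull_poly_deriv ij.
have -> : gpartial j (\prod_(i in I) gpull_dt i) = 0.
  elim/big_rec: _ => [|l x _ IH].
    by rewrite -(rmorph1 (@gpoly k p)) gpartial_mono -mpolyC1 mderivC raddf0.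
  rewrite gpartialM IH mulr0 addr0 linear_sum big1 ?mul0r // => l' _ /=.
  by rewrite gpartial_gdt.
by rewrite mulr0 addr0.
Qed.

End Pullback.
Local Open Scope quotient_scope.

Definition Omega (k : fieldType) (p : nat) : Type := Quotient.quot (gideal k p).

HB.instance Definition _ k p := GRing.Zmodule.on (Omega k p).
HB.instance Definition _ k p :=
  EqQuotient.copy (Omega k p) (Quotient.quot (gideal k p)).

Section OmegaTheory.
Variables (k : fieldType) (p : nat).
Local Notation E := (gform k p).
Local Notation O := (Omega k p).

Definition opi (a : E) : O := \pi_(Quotient.quot (gideal k p)) a.

Fact opi_is_zmod : zmod_morphism opi.
Proof. exact: pi_is_zmod_morphism. Qed.
HB.instance Definition _ := GRing.isZmodMorphism.Build E O opi opi_is_zmod.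

Lemma opi_repr (w : O) : opi (repr w) = w. Proof. exact: reprK. Qed.

Lemma opi_eq a b : (opi a == opi b) = (a - b \in gideal k p).
Proof. by rewrite Quotient.idealrBE. Qed.

Lemma opi_eq0 a : (opi a == 0) = (a \in gideal k p).
Proof. by rewrite -(raddf0 opi) opi_eq subr0. Qed.

Lemma repr_opi a : repr (opi a) - a \in gideal k p.
Proof. by rewrite -opi_eq opi_repr. Qed.

Definition oscale (x : k) (w : O) : O := opi (x *: repr w).

Lemma oscale_opi x a : oscale x (opi a) = opi (x *: a).
Proof. by apply/eqP; rewrite opi_eq -scalerBr rpredZ ?repr_opi. Qed.

Fact oscaleA x y w : oscale x (oscale y w) = oscale (x * y) w.
Proof. by rewrite -(opi_repr w) !oscale_opi scalerA. Qed.
Fact oscale1 : left_id 1 oscale.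
Proof. by move=> w; rewrite -(opi_repr w) oscale_opi scale1r. Qed.
Fact oscaleDr : right_distributive oscale +%R.
Proof.
move=> x v w; rewrite -(opi_repr v) -(opi_repr w) !oscale_opi -!(raddfD opi).
by rewrite oscale_opi scalerDr.
Qed.
Fact oscaleDl w : {morph oscale^~ w : x y / x + y}.
Proof.
by move=> x y; rewrite -(opi_repr w) !oscale_opi -(raddfD opi) scalerDl.
Qed.
HB.instance Definition _ := GRing.Zmodule_isLmodule.Build k O
  oscaleA oscale1 oscaleDr oscaleDl.

Fact opi_is_scalable : scalable opi.
Proof. by move=> x a; rewrite -oscale_opi. Qed.
HB.instance Definition _ := GRing.isScalable.Build k E O *:%R opi
  opi_is_scalable.

(* Omega^n_p is the image of the elements of degree n. *)
Definition odegree n : {pred O} :=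
  fun w => `[< exists2 a, a \in ghomog k p n & w = opi a >].

Fact odegree_submod_closed n : submod_closed (odegree n).
Proof.
split; first by apply/asboolP; exists 0; rewrite ?rpred0 ?raddf0.
move=> x _ _ /asboolP[a ha ->] /asboolP[b hb ->]; apply/asboolP.
by exists (x *: a + b); rewrite ?linearP // rpredD // rpredZ.
Qed.
HB.instance Definition _ n := GRing.isSubmodClosed.Build k O (odegree n)
  (odegree_submod_closed n).

Record Omegan n := OmeganOf { omegan_val :> O; _ : omegan_val \in odegree n }.
HB.instance Definition _ n := [isSub for @omegan_val n].
HB.instance Definition _ n := [Choice of Omegan n by <:].
HB.instance Definition _ n := [SubChoice_isSubLmodule of Omegan n by <:].

End OmegaTheory.

Arguments odegree : clear implicits.

Lemma Omegan_eq k p n (v w : Omegan k p n) : (v : Omega k p) = w -> v = w.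
Proof. exact: val_inj. Qed.

Section Descend.
Variables (k : fieldType) (q p : nat) (f : {linear gform k q -> gform k p}).
Hypothesis f_ideal : forall a, a \in gideal k q -> f a \in gideal k p.
Variables (m n : nat).
Hypothesis f_homog : forall a, a \in ghomog k q m -> f a \in ghomog k p n.

Definition omap (w : Omega k q) : Omega k p := opi (f (repr w)).

Lemma omap_opi a : omap (opi a) = opi (f a).
Proof. by apply/eqP; rewrite opi_eq -linearB f_ideal ?repr_opi. Qed.

Lemma omap_is_linear : linear omap.
Proof.
move=> x v w; rewrite -(opi_repr v) -(opi_repr w) -linearP !omap_opi.
by rewrite !linearP.
Qed.

Fact omap_degree (w : Omegan k q m) : omap w \in odegree k p n.
Proof.
case: w => w /= /asboolP[a ha ->]; rewrite omap_opi.
by apply/asboolP; exists (f a); rewrite ?f_homog.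
Qed.

Definition omapn (w : Omegan k q m) : Omegan k p n := OmeganOf (omap_degree w).

Fact omapn_is_linear : linear omapn.
Proof. by move=> x v w; apply: val_inj; rewrite /= omap_is_linear. Qed.

End Descend.

Definition od (k : fieldType) p n : Omegan k p n -> Omegan k p n.+1 :=
  omapn (@gd_ideal k p) (@gd_homog k p n).
HB.instance Definition _ (k : fieldType) p n := GRing.isLinear.Build k
  (Omegan k p n) (Omegan k p n.+1) *:%R (@od k p n) (omapn_is_linear _ _).

Definition opull (k : fieldType) p q n (alpha : 'I_p.+1 -> 'I_q.+1) :
    Omegan k q n -> Omegan k p n :=
  omapn (@gpull_ideal k p q alpha) (@gpull_homog k p q alpha n).
HB.instance Definition _ (k : fieldType) p q n (alpha : 'I_p.+1 -> 'I_q.+1) :=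
  GRing.isLinear.Build k (Omegan k q n) (Omegan k p n) *:%R
    (@opull k p q n alpha) (omapn_is_linear _ _).

Section OmegaMaps.
Variable k : fieldType.

Lemma od_od p n (w : Omegan k p n) : od (od w) = 0.
Proof.
apply: val_inj => /=; rewrite -(opi_repr w) !(omap_opi (@gd_ideal k p)).
by rewrite /= gd_gd raddf0.
Qed.

Lemma opull_od p q n (alpha : 'I_p.+1 -> 'I_q.+1) (w : Omegan k q n) :
  opull alpha (od w) = od (opull alpha w).
Proof.
apply: val_inj => /=; rewrite -(opi_repr w).
rewrite (omap_opi (@gd_ideal k q)) !(omap_opi (@gpull_ideal k p q alpha)).
by rewrite (omap_opi (@gd_ideal k p)) /= gpull_gd.
Qed.

End OmegaMaps.
(* The tensor product over k of a k-module M and an A-module X, where k acts on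
   X through iota : k -> A. A sequence of pairs stands for the sum of the
   corresponding pure tensors. *)
Section TensorRel.
Variables (k A : comPzRingType) (iota : {rmorphism k -> A}).
Variables (M : lmodType k) (X : lmodType A).

Inductive tens_rel : seq (M * X) -> seq (M * X) -> Prop :=
| TensRefl s : tens_rel s s
| TensSym s t of tens_rel s t : tens_rel t s
| TensTrans s t u of tens_rel s t & tens_rel t u : tens_rel s u
| TensCat s s' t t' of tens_rel s s' & tens_rel t t' :
    tens_rel (s ++ t) (s' ++ t')
| TensComm s t : tens_rel (s ++ t) (t ++ s)
| TensZero x : tens_rel [:: (0, x)] [::]
| TensAddl m m' x : tens_rel [:: (m + m', x)] [:: (m, x); (m', x)]
| TensAddr m x x' : tens_rel [:: (m, x + x')] [:: (m, x); (m, x')]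
| TensScale c m x : tens_rel [:: (c *: m, x)] [:: (m, iota c *: x)].

Definition tens_relb s t : bool := `[< tens_rel s t >].

Fact tens_relb_equiv : equiv_class_of tens_relb.
Proof.
split=> [s|s t|t s u].
- by apply/asboolP; apply: TensRefl.
- by apply/asboolP/asboolP; apply: TensSym.
- by move=> /asboolP h1 /asboolP h2; apply/asboolP; apply: TensTrans h1 h2.
Qed.
Canonical tens_relb_equivRel := EquivRelPack tens_relb_equiv.

Definition tensor : Type := {eq_quot tens_relb}.
HB.instance Definition _ := Choice.on tensor.

Definition tpi (s : seq (M * X)) : tensor := \pi_({eq_quot tens_relb}) s.

Definition trepr (u : tensor) : seq (M * X) := repr (u : {eq_quot tens_relb}).

Lemma tpi_repr u : tpi (trepr u) = u. Proof. exact: reprK. Qed.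

Lemma tpiP s t : tpi s = tpi t <-> tens_rel s t.
Proof.
split=> [/eqP|h]; first by rewrite eqmodE => /asboolP.
by apply/eqP; rewrite eqmodE; apply/asboolP.
Qed.

Lemma trepr_pi s : tens_rel (trepr (tpi s)) s.
Proof. by apply/tpiP; rewrite tpi_repr. Qed.

Lemma tensW (Q : tensor -> Prop) : (forall s, Q (tpi s)) -> forall u, Q u.
Proof. by move=> h u; rewrite -(tpi_repr u). Qed.

End TensorRel.

Section TensorMapRel.
Variables (k A : comPzRingType) (iota : {rmorphism k -> A}).
Variables (M M' : lmodType k) (X X' : lmodType A).
Variables (f : {linear M -> M'}) (g : {linear X -> X'}).

Definition smap (s : seq (M * X)) : seq (M' * X') :=
  [seq (f u.1, g u.2) | u <- s].

Lemma smap_rel s t : tens_rel iota s t -> tens_rel iota (smap s) (smap t).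
Proof.
elim=> {s t}.
- by move=> s; apply: TensRefl.
- by move=> s t _; apply: TensSym.
- by move=> s t u _ h1 _ h2; apply: TensTrans h1 h2.
- by move=> s s' t t' _ h1 _ h2; rewrite /smap !map_cat; apply: TensCat.
- by move=> s t; rewrite /smap !map_cat; apply: TensComm.
- by move=> x; rewrite /= linear0; apply: TensZero.
- by move=> m m' x; rewrite /= linearD; apply: TensAddl.
- by move=> m x x'; rewrite /= linearD; apply: TensAddr.
- by move=> c m x; rewrite /= !linearZ; apply: TensScale.
Qed.

Definition tmap (u : tensor iota M X) : tensor iota M' X' :=
  tpi iota (smap (trepr u)).

Lemma tmap_pi s : tmap (tpi iota s) = tpi iota (smap s).
Proof. by apply/tpiP; apply/smap_rel/trepr_pi. Qed.

End TensorMapRel.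

Section Tensor.
Variables (k A : comPzRingType) (iota : {rmorphism k -> A}).
Variables (M : lmodType k) (X : lmodType A).
Local Notation T := (tensor iota M X).
Local Notation tpi := (@tpi k A iota M X).

Definition tadd (u v : T) : T := tpi (trepr u ++ trepr v).

Lemma tadd_pi s t : tadd (tpi s) (tpi t) = tpi (s ++ t).
Proof. by apply/tpiP; apply: TensCat; apply: trepr_pi. Qed.

Definition topp : T -> T := tmap (-%R : {linear M -> M}) idfun.

Fact taddA : associative tadd.
Proof.
by elim/tensW=> s; elim/tensW=> t; elim/tensW=> u; rewrite !tadd_pi catA.
Qed.
Fact taddC : commutative tadd.
Proof.
elim/tensW=> s; elim/tensW=> t; rewrite !tadd_pi.
by apply/tpiP; apply: TensComm.
Qed.
Fact tadd0 : left_id (tpi [::]) tadd.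
Proof. by elim/tensW=> s; rewrite tadd_pi. Qed.
Fact taddN : left_inverse (tpi [::]) topp tadd.
Proof.
elim/tensW; elim=> [|[m x] s IH]; first by rewrite /topp tmap_pi tadd_pi.
rewrite -cat1s -tadd_pi {1}tadd_pi /topp tmap_pi [smap _ _ _]/= -cat1s -tadd_pi.
rewrite -tmap_pi -/topp -taddA [X in tadd _ X]taddA [X in tadd X (tpi s)]taddC.
rewrite -taddA IH taddA tadd_pi [RHS](_ : _ = tadd (tpi [:: (- m + m, x)]) (tpi [::])).
  by congr (tadd _ _); apply/tpiP; apply: TensSym; apply: TensAddl.
by rewrite tadd_pi addNr; apply/tpiP; apply: TensSym; apply: TensZero.
Qed.

HB.instance Definition _ := GRing.isZmodule.Build T taddA taddC tadd0 taddN.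

(* A acts through the second factor. *)
Definition tscale (a : A) : T -> T :=
  tmap (idfun : {linear M -> M}) ( *:%R a : {linear X -> X}).

Lemma tpiD s t : tpi (s ++ t) = tpi s + tpi t.
Proof. by rewrite -tadd_pi. Qed.

Lemma tpi_cons u s : tpi (u :: s) = tpi [:: u] + tpi s.
Proof. by rewrite -tpiD. Qed.

Fact tscaleA a b u : tscale a (tscale b u) = tscale (a * b) u.
Proof.
elim/tensW: u => s; rewrite /tscale !tmap_pi /smap -map_comp; congr tpi.
by apply: eq_map => -[m x] /=; rewrite scalerA.
Qed.
Fact tscale1 : left_id 1 tscale.
Proof.
elim/tensW=> s; rewrite /tscale tmap_pi; congr tpi.
by rewrite -[RHS]map_id; apply: eq_map => -[m x] /=; rewrite scale1r.
Qed.
Fact tscaleDr : right_distributive tscale +%R.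
Proof.
move=> a; elim/tensW=> s; elim/tensW=> t.
by rewrite -tpiD /tscale !tmap_pi /smap map_cat tpiD.
Qed.
Fact tscaleDl u : {morph tscale^~ u : a b / a + b}.
Proof.
move=> a b; elim/tensW: u => s; rewrite /tscale !tmap_pi.
elim: s => [|[m x] s IH]; first by rewrite -tpiD.
rewrite /= ![tpi (_ :: smap _ _ s)]tpi_cons IH addrACA; congr (_ + _).
rewrite -tpiD scalerDl.
by apply/tpiP; apply: TensAddr.
Qed.
HB.instance Definition _ := GRing.Zmodule_isLmodule.Build A T
  tscaleA tscale1 tscaleDr tscaleDl.

Definition tens (m : M) (x : X) : T := tpi [:: (m, x)].

Lemma tens_ind (Q : T -> Prop) :
  Q 0 -> (forall m x u, Q u -> Q (tens m x + u)) -> forall u, Q u.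
Proof.
move=> Q0 QD; elim/tensW; elim=> [//|[m x] s IH].
by rewrite -cat1s tpiD; apply: QD.
Qed.

Lemma tensDl m m' x : tens (m + m') x = tens m x + tens m' x.
Proof. by rewrite -tpiD; apply/tpiP; apply: TensAddl. Qed.

Lemma tensDr m x x' : tens m (x + x') = tens m x + tens m x'.
Proof. by rewrite -tpiD; apply/tpiP; apply: TensAddr. Qed.

Lemma tens_scale c m x : tens (c *: m) x = tens m (iota c *: x).
Proof. by apply/tpiP; apply: TensScale. Qed.

Lemma tensZr a m x : tens m (a *: x) = a *: tens m x.
Proof. by rewrite [RHS]tmap_pi. Qed.

End Tensor.

Arguments tens {k A} iota {M X}.

Section TensorMap.
Variables (k A : comPzRingType) (iota : {rmorphism k -> A}).

Section Linear.
Variables (M M' : lmodType k) (X X' : lmodType A).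
Variables (f : {linear M -> M'}) (g : {linear X -> X'}).
Local Notation F := (@tmap k A iota M M' X X' f g).

Fact tmap_is_linear : linear F.
Proof.
move=> a; elim/tensW=> s; elim/tensW=> t.
rewrite [a *: _]tmap_pi -tpiD !tmap_pi [a *: _]tmap_pi /smap map_cat tpiD.
congr (_ + _); rewrite -!map_comp; congr tpi; apply: eq_map => -[m x] /=.
by rewrite linearZ.
Qed.
HB.instance Definition _ := GRing.isLinear.Build A
  (tensor iota M X) (tensor iota M' X') *:%R F tmap_is_linear.

Lemma tmap_tens m x : F (tens iota m x) = tens iota (f m) (g x).
Proof. exact: tmap_pi. Qed.

End Linear.

Lemma tmap_id (M : lmodType k) (X : lmodType A) (u : tensor iota M X) :
  tmap idfun idfun u = u.
Proof.
elim/tens_ind: u => [|m x u IH]; first by rewrite linear0.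
by rewrite linearD /= IH tmap_tens.
Qed.

Lemma tmap_comp (M M' M'' : lmodType k) (X X' X'' : lmodType A)
    (f : {linear M -> M'}) (f' : {linear M' -> M''})
    (g : {linear X -> X'}) (g' : {linear X' -> X''}) (u : tensor iota M X) :
  tmap f' g' (tmap f g u) = tmap (f' \o f) (g' \o g) u.
Proof.
elim/tens_ind: u => [|m x u IH]; first by rewrite !linear0.
by rewrite !linearD /= IH !tmap_tens.
Qed.

Lemma eq_tmap (M M' : lmodType k) (X X' : lmodType A)
    (f f' : {linear M -> M'}) (g g' : {linear X -> X'}) :
  f =1 f' -> g =1 g' -> forall u : tensor iota M X, tmap f g u = tmap f' g' u.
Proof.
move=> ef eg; elim/tens_ind => [|m x u IH]; first by rewrite !linear0.
by rewrite !linearD /= IH !tmap_tens ef eg.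
Qed.

End TensorMap.
Definition short_exact (A : pzRingType) (U V W : lmodType A)
    (f : {linear U -> V}) (g : {linear V -> W}) : Prop :=
  [/\ injective f, forall v, g v = 0 <-> exists u, f u = v
    & forall w, exists v, g v = w].

Section Cosimplicial.
Variable A : pzRingType.

Record cosimplicial := Cosimplicial {
  cs_obj :> nat -> lmodType A;
  cs_map : forall p q, {omorphism 'I_p.+1 -> 'I_q.+1} ->
    {linear cs_obj p -> cs_obj q};
  cs_map_id : forall p (x : cs_obj p), cs_map idfun x = x;
  cs_map_comp : forall p q r (beta : {omorphism 'I_q.+1 -> 'I_r.+1})
    (alpha : {omorphism 'I_p.+1 -> 'I_q.+1}) (x : cs_obj p),
    cs_map (beta \o alpha) x = cs_map beta (cs_map alpha x) }.

Record cosimplicial_hom (X Y : cosimplicial) := CosimplicialHom {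
  cs_hom :> forall p, {linear X p -> Y p};
  cs_hom_nat : forall p q (alpha : {omorphism 'I_p.+1 -> 'I_q.+1}) (x : X p),
    cs_hom q (cs_map X alpha x) = cs_map Y alpha (cs_hom p x) }.

Definition cosimplicial_id X : cosimplicial_hom X X :=
  @CosimplicialHom X X (fun p => idfun) (fun p q alpha x => erefl).

Fact cosimplicial_comp_nat X Y Z (g : cosimplicial_hom Y Z)
    (f : cosimplicial_hom X Y) p q (alpha : {omorphism 'I_p.+1 -> 'I_q.+1})
    (x : X p) :
  (g q \o f q) (cs_map X alpha x) = cs_map Z alpha ((g p \o f p) x).
Proof. by rewrite /= !cs_hom_nat. Qed.

Definition cosimplicial_comp X Y Z (g : cosimplicial_hom Y Z)
    (f : cosimplicial_hom X Y) : cosimplicial_hom X Z :=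
  CosimplicialHom (cosimplicial_comp_nat g f).

Definition cosimplicial_short_exact X Y Z (f : cosimplicial_hom X Y)
    (g : cosimplicial_hom Y Z) : Prop :=
  forall p, short_exact (f p) (g p).

End Cosimplicial.

Section Complexes.
Variable A : pzRingType.

Record cochain_complex := CochainComplex {
  cc_obj :> nat -> lmodType A;
  cc_d : forall n, {linear cc_obj n -> cc_obj n.+1};
  cc_d_d : forall n (x : cc_obj n), cc_d n.+1 (cc_d n x) = 0 }.

Record cochain_hom (C D : cochain_complex) := CochainHom {
  cc_hom :> forall n, {linear C n -> D n};
  cc_hom_d : forall n (x : C n), cc_hom n.+1 (cc_d C n x) = cc_d D n (cc_hom n x)
}.

Definition cochain_short_exact C D E (f : cochain_hom C D)
    (g : cochain_hom D E) : Prop :=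
  forall n, short_exact (f n) (g n).

Record cosimplicial_functor := CosimplicialFunctor {
  cf_obj :> cosimplicial A -> cochain_complex;
  cf_map : forall X Y, cosimplicial_hom X Y -> cochain_hom (cf_obj X) (cf_obj Y);
  cf_map_id : forall X n (x : cf_obj X n),
    cf_map (cosimplicial_id X) n x = x;
  cf_map_comp : forall X Y Z (g : cosimplicial_hom Y Z)
    (f : cosimplicial_hom X Y) n (x : cf_obj X n),
    cf_map (cosimplicial_comp g f) n x = cf_map g n (cf_map f n x) }.

Definition exact_functor (F : cosimplicial_functor) : Prop :=
  forall X Y Z (f : cosimplicial_hom X Y) (g : cosimplicial_hom Y Z),
  cosimplicial_short_exact f g -> cochain_short_exact (cf_map F f) (cf_map F g).

End Complexes.

(* A commutative k-algebra is a commutative ring A with its structure morphism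
   iota : k -> A (the zero ring is allowed). *)
Section ThomSullivan.
Variables (k : fieldType) (A : comPzRingType) (iota : {rmorphism k -> A}).

Section Object.
Variables (X : cosimplicial A) (n : nat).

Definition ts_compatible (x : forall p, tensor iota (Omegan k p n) (X p)) :=
  forall p q (alpha : {omorphism 'I_p.+1 -> 'I_q.+1}),
  tmap (opull alpha) idfun (x q) = tmap idfun (cs_map X alpha) (x p).

Record thom_sullivan_module := ThomSullivanModule {
  ts_val :> forall p, tensor iota (Omegan k p n) (X p);
  ts_compat : ts_compatible ts_val }.
Local Notation TS := thom_sullivan_module.

Lemma ts_ext (x y : TS) : (forall p, x p = y p) -> x = y.
Proof.
case: x y => [x hx] [y hy] /= exy.
have {}exy : x = y by apply: functional_extensionality_dep.
by subst y; congr ThomSullivanModule; apply: Prop_irrelevance.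
Qed.

HB.instance Definition _ := gen_eqMixin TS.
HB.instance Definition _ := gen_choiceMixin TS.

Fact ts_zero_compat : ts_compatible (fun p => 0).
Proof. by move=> p q alpha; rewrite !linear0. Qed.
Fact ts_opp_compat (x : TS) : ts_compatible (fun p => - x p).
Proof. by move=> p q alpha; rewrite !linearN /= ts_compat. Qed.
Fact ts_add_compat (x y : TS) : ts_compatible (fun p => x p + y p).
Proof. by move=> p q alpha; rewrite !linearD /= !ts_compat. Qed.
Fact ts_scale_compat (a : A) (x : TS) : ts_compatible (fun p => a *: x p).
Proof. by move=> p q alpha; rewrite !linearZ /= ts_compat. Qed.

Definition ts_zero : TS := ThomSullivanModule ts_zero_compat.
Definition ts_opp (x : TS) : TS := ThomSullivanModule (ts_opp_compat x).
Definition ts_add (x y : TS) : TS := ThomSullivanModule (ts_add_compat x y).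
Definition ts_scale (a : A) (x : TS) : TS :=
  ThomSullivanModule (ts_scale_compat a x).

Fact ts_addA : associative ts_add.
Proof. by move=> x y z; apply: ts_ext => p /=; rewrite addrA. Qed.
Fact ts_addC : commutative ts_add.
Proof. by move=> x y; apply: ts_ext => p /=; rewrite addrC. Qed.
Fact ts_add0 : left_id ts_zero ts_add.
Proof. by move=> x; apply: ts_ext => p /=; rewrite add0r. Qed.
Fact ts_addN : left_inverse ts_zero ts_opp ts_add.
Proof. by move=> x; apply: ts_ext => p /=; rewrite addNr. Qed.
HB.instance Definition _ := GRing.isZmodule.Build TS
  ts_addA ts_addC ts_add0 ts_addN.

Fact ts_scaleA a b x : ts_scale a (ts_scale b x) = ts_scale (a * b) x.
Proof. by apply: ts_ext => p /=; rewrite scalerA. Qed.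
Fact ts_scale1 : left_id 1 ts_scale.
Proof. by move=> x; apply: ts_ext => p /=; rewrite scale1r. Qed.
Fact ts_scaleDr : right_distributive ts_scale +%R.
Proof. by move=> a x y; apply: ts_ext => p /=; rewrite scalerDr. Qed.
Fact ts_scaleDl x : {morph ts_scale^~ x : a b / a + b}.
Proof. by move=> a b; apply: ts_ext => p /=; rewrite scalerDl. Qed.
HB.instance Definition _ := GRing.Zmodule_isLmodule.Build A TS
  ts_scaleA ts_scale1 ts_scaleDr ts_scaleDl.

End Object.

Section Differential.
Variables (X : cosimplicial A) (n : nat).

Fact ts_d_compat (x : thom_sullivan_module X n) :
  ts_compatible (fun p => tmap (@od k p n) idfun (x p)).
Proof.
move=> p q alpha.
transitivity (tmap (@od k p n) idfun (tmap (opull alpha) idfun (x q))).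
  by rewrite !tmap_comp; apply: eq_tmap => // w /=; rewrite opull_od.
by rewrite ts_compat !tmap_comp; apply: eq_tmap.
Qed.

Definition ts_d (x : thom_sullivan_module X n) : thom_sullivan_module X n.+1 :=
  ThomSullivanModule (ts_d_compat x).

Fact ts_d_is_linear : linear ts_d.
Proof. by move=> a x y; apply: ts_ext => p /=; rewrite linearP. Qed.
HB.instance Definition _ := GRing.isLinear.Build A
  (thom_sullivan_module X n) (thom_sullivan_module X n.+1) *:%R ts_d
  ts_d_is_linear.

End Differential.

Fact ts_d_d X n (x : thom_sullivan_module X n) : ts_d (ts_d x) = 0.
Proof.
apply: ts_ext => p /=; rewrite tmap_comp; elim/tens_ind: (x p) => [|w y u IH].
  by rewrite linear0.
rewrite linearD /= IH tmap_tens /= od_od addr0.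
by rewrite -(scale0r 0) tens_scale rmorph0 scale0r -(scale0r 0) tensZr scale0r.
Qed.

Definition thom_sullivan_complex (X : cosimplicial A) : cochain_complex A :=
  CochainComplex (@ts_d_d X).

Section Map.
Variables (X Y : cosimplicial A) (f : cosimplicial_hom X Y).

Fact ts_map_compat n (x : thom_sullivan_module X n) :
  ts_compatible (fun p => tmap idfun (f p) (x p)).
Proof.
move=> p q alpha.
transitivity (tmap idfun (f q) (tmap (opull alpha) idfun (x q))).
  by rewrite !tmap_comp; apply: eq_tmap.
rewrite ts_compat !tmap_comp; apply: eq_tmap => // y /=.
by rewrite cs_hom_nat.
Qed.

Definition ts_map n (x : thom_sullivan_module X n) : thom_sullivan_module Y n :=
  ThomSullivanModule (ts_map_compat x).

Fact ts_map_is_linear n : linear (@ts_map n).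
Proof. by move=> a x y; apply: ts_ext => p /=; rewrite linearP. Qed.
HB.instance Definition _ n := GRing.isLinear.Build A
  (thom_sullivan_module X n) (thom_sullivan_module Y n) *:%R (@ts_map n)
  (@ts_map_is_linear n).

Fact ts_map_d n (x : thom_sullivan_module X n) :
  ts_map (ts_d x) = ts_d (ts_map x).
Proof.
by apply: ts_ext => p /=; rewrite !tmap_comp; apply: eq_tmap.
Qed.

Definition thom_sullivan_map :
    cochain_hom (thom_sullivan_complex X) (thom_sullivan_complex Y) :=
  @CochainHom A (thom_sullivan_complex X) (thom_sullivan_complex Y)
    (fun n => @ts_map n) ts_map_d.

End Map.

Fact thom_sullivan_map_id X n (x : thom_sullivan_complex X n) :
  thom_sullivan_map (cosimplicial_id X) n x = x.
Proof. by apply: ts_ext => p /=; rewrite tmap_id. Qed.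

Fact thom_sullivan_map_comp X Y Z (g : cosimplicial_hom Y Z)
    (f : cosimplicial_hom X Y) n (x : thom_sullivan_complex X n) :
  thom_sullivan_map (cosimplicial_comp g f) n x
  = thom_sullivan_map g n (thom_sullivan_map f n x).
Proof.
by apply: ts_ext => p /=; rewrite tmap_comp; apply: eq_tmap.
Qed.

Definition thom_sullivan : cosimplicial_functor A :=
  CosimplicialFunctor thom_sullivan_map_id thom_sullivan_map_comp.

End ThomSullivan.

(* Main.v *)
(* The degree n part of Omega(X) consists of the compatible families in the
   tensor products of Omega^n_p with X^p. Left exactness is pointwise, a vector
   space being flat over k.

   For right exactness, a compatible family z in Z is lifted to Y by induction
   on p. A first lift y_(p+1) of z_(p+1) is corrected by means of cofaces so
   that it satisfies the codegeneracy conditions. The remaining defects a_i on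
   the faces are killed by all codegeneracies and by Y -> Z, so any correction
   built by operators on Omega alone is harmless. Since forms pull back along
   all maps of vertices, the collapses of the other vertices onto a fixed vertex
   v are commuting idempotents, and they give a form F_v restricting to a_i on
   every face i <> v. As t_i vanishes on the face i and the t_v add up to 1, the
   sum of the t_v F_v restricts to a_i on every face i. *)

From HB Require Import structures.
Require Import Defs.
From mathcomp Require Import all_boot all_order all_algebra.
From mathcomp Require Import boolp classical_sets zify.
From mathcomp Require Import mpoly.

Set Implicit Arguments.
Unset Strict Implicit.
Unset Printing Implicit Defensive.

Import GRing.Theory.
Local Open Scope ring_scope.

(** * Separating a vector from a subspace by a linear functional *)

Section Functional.
Variables (k : fieldType) (V : lmodType k).

Definition subspace (S : set V) : Prop :=
  S 0 /\ forall c u v, S u -> S v -> S (c *: u + v).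

(** Zorn's lemma: if [u] lay outside the span of [U] and [v], then the span of [U] and [u] would
    still avoid [v], against maximality. *)
Lemma maximal_subspace_avoiding (S : set V) v : subspace S -> ~ S v ->
  exists U : set V, [/\ subspace U, forall s, S s -> U s, ~ U v &
    forall u, exists c, U (u - c *: v)].
Proof.
move=> [S0 SL] nSv.
pose P (U : set V) := (forall u, ~ U u) \/
  [/\ subspace U, forall s, S s -> U s & ~ U v].
case: (@Zorn_bigcup V P) => [F FP Ftot|U [PU Umax]].
  have [[U [FU [u Uu]]]|Fe] := pselect (exists U, F U /\ exists u, U u).
    right; have PF W w : F W -> W w -> [/\ subspace W, forall s, S s -> W s & ~ W v].
      by move=> FW Ww; case: (FP _ FW) => // /(_ w).
    have [[U0 UL] SU nUv] := PF _ _ FU Uu.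
    split=> [|s /SU Us|[W FW Wv]]; last by case: (PF _ _ FW Wv).
      split; first by exists U.
      move=> c x y [W1 F1 Wx] [W2 F2 Wy].
      have [h|h] := Ftot _ _ F1 F2.
        exists W2 => //; have [[_ L] _ _] := PF _ _ F2 Wy.
        by apply: L => //; apply: h.
      exists W1 => //; have [[_ L] _ _] := PF _ _ F1 Wx.
      by apply: L => //; apply: h.
    by exists U.
  by left=> u [U FU Uu]; apply: Fe; exists U; split=> //; exists u.
have [[U0 UL] SU nUv] : [/\ subspace U, forall s, S s -> U s & ~ U v].
  case: PU => // Ue; exfalso; apply: (Umax S); last by right; split.
  by split=> [u /Ue //|SU]; apply: (Ue 0); apply: SU.
exists U; split=> // u; apply: contrapT => nu.
pose W : set V := fun w => exists c, U (w - c *: u).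
apply: (Umax W).
  split=> [w Uw|WU]; first by exists 0; rewrite scale0r subr0.
  apply: nu; exists 0; rewrite scale0r subr0; apply: WU; exists 1.
  by rewrite scale1r subrr.
right; split=> [|s Ss|[c Uc]].
- split; first by exists 0; rewrite scale0r subr0.
  move=> c x y [a Ua] [b Ub]; exists (c * a + b).
  have := UL c _ _ Ua Ub; congr U.
  by rewrite scalerBr scalerDl scalerA opprD addrACA.
- by exists 0; rewrite scale0r subr0; apply: SU.
have [c0|nc0] := eqVneq c 0; first by apply: nUv; move: Uc; rewrite c0 scale0r subr0.
apply: nu; exists c^-1; have := UL (- c^-1) _ _ Uc U0; congr U.
by rewrite addr0 scalerBr !scaleNr scalerA mulVf // scale1r opprK addrC.
Qed.

(** The value at [u] is the scalar [c] with [u - c *: v] in a maximal subspace avoiding [v];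
    uniqueness of [c] gives linearity. *)
Lemma separating_functional (S : set V) v : subspace S -> ~ S v ->
  exists phi : {linear V -> k^o}, phi v = 1 /\ forall s, S s -> phi s = 0.
Proof.
move=> subS nSv.
have [U [[U0 UL] SU nUv /choice[phi Uphi]]] := maximal_subspace_avoiding subS nSv.
have phi_uniq u c : U (u - c *: v) -> phi u = c.
  move=> Uc; apply/eqP; rewrite -subr_eq0; apply/negPn/negP => ne.
  apply: nUv; have := UL (- 1) _ _ (Uphi u) Uc.
  rewrite scaleN1r opprB addrA subrK -scalerBl => Ud.
  have := UL (phi u - c)^-1 _ _ Ud U0.
  by rewrite addr0 scalerA mulVf // scale1r.
have lin : linear (phi : V -> k^o).
  move=> c x y; apply: phi_uniq; have := UL c _ _ (Uphi x) (Uphi y); congr U.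
  by rewrite scalerBr scalerDl scalerA opprD addrACA.
pose psi : {linear V -> k^o} := HB.pack (phi : V -> k^o)
  (GRing.isLinear.Build k V k^o *:%R (phi : V -> k^o) lin).
exists psi; split=> [|s Ss].
  by apply: phi_uniq; rewrite scale1r subrr.
by apply: phi_uniq; rewrite scale0r subr0; apply: SU.
Qed.

End Functional.

(** * Kernels of maps induced on tensor products over a field *)

Section TensorExact.
Variables (k : fieldType) (A : comPzRingType) (iota : {rmorphism k -> A}).
Variables (M : lmodType k).

Lemma tens_cons (X : lmodType A) m (x : X) s :
  tpi iota ((m, x) :: s) = tens iota m x + tpi iota s :> tensor iota M X.
Proof. exact: tpi_cons. Qed.

Lemma tens0l (X : lmodType A) (x : X) : tens iota (0 : M) x = 0.
Proof. by apply/tpiP; apply: TensZero. Qed.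

Lemma tens0r (X : lmodType A) m : tens iota m (0 : X) = 0 :> tensor iota M X.
Proof. by have := tensZr iota 0 m (0 : X); rewrite !scale0r. Qed.

Section Contraction.
Variables (X : lmodType A) (phi : {linear M -> k^o}).

(** Makes the contraction of a pure tensor of [m] and [x] to [iota (phi m) *: x] well defined on the
    tensor product. *)
Lemma contraction_rel (s t : seq (M * X)) : tens_rel iota s t ->
  \sum_(w <- s) iota (phi w.1) *: w.2 = \sum_(w <- t) iota (phi w.1) *: w.2.
Proof.
elim=> {s t} => //.
- by move=> s t u _ -> _ ->.
- by move=> s s' t t' _ h1 _ h2; rewrite !big_cat h1 h2.
- by move=> s t; rewrite !big_cat /= addrC.
- by move=> x; rewrite big_seq1 big_nil linear0 rmorph0 scale0r.
- by move=> m m' x; rewrite !big_cons !big_nil !addr0 linearD rmorphD scalerDl.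
- by move=> m x x'; rewrite !big_cons !big_nil !addr0 scalerDr.
- by move=> c m x; rewrite !big_seq1 linearZ /= rmorphM scalerA mulrC.
Qed.

End Contraction.

Section Absorption.
Variables (X : lmodType A) (ms : seq M).

(* Holds for the linear combinations [v] of [ms]: a term with such a left factor
   can be absorbed without lengthening the tensor. *)
Definition absorbed : set M := fun v => forall (x : X) s, map fst s = ms ->
  exists t, map fst t = ms /\ tens iota v x + tpi iota s = tpi iota t.

Lemma absorbed_subspace : subspace absorbed.
Proof.
split=> [x s es|c u v hu hv x s es]; first by exists s; rewrite tens0l add0r.
have [t [et e]] := hv x s es; have [t' [et' e']] := hu (iota c *: x) t et.
by exists t'; split=> //; rewrite tensDl tens_scale -addrA e.
Qed.

(** [x] is added to the right factor that stands next to an occurrence of [m]. *)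
Lemma mem_absorbed m : m \in ms -> absorbed m.
Proof.
move=> mms x s es; move: mms; rewrite -es => /mapP[[m' y] /= ys ->].
have [i li ei] : exists2 i, (i < size s)%N & nth (m, x) s i = (m', y).
  by exists (index (m', y) s); rewrite ?index_mem ?nth_index.
exists (set_nth (m, x) s i (m', y + x)); rewrite set_nthE li; split.
  rewrite -[in RHS](cat_take_drop i s) (drop_nth (m, x) li) ei.
  by rewrite !map_cat.
rewrite -[in LHS](cat_take_drop i s) (drop_nth (m, x) li) ei !tpiD.
rewrite !tens_cons tensDr.
by rewrite addrCA; congr (_ + _); rewrite addrCA addrA.
Qed.

End Absorption.

(* If the first left factor is a combination of the others, the sum can be
   shortened; if not, a functional separating it from them shows that g kills
   the first right factor. *)
Lemma tmap_ker (X Y : lmodType A) (g : {linear X -> Y}) (u : tensor iota M X) :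
  tmap idfun g u = 0 ->
  exists s, (forall w, w \in s -> g w.2 = 0) /\ u = tpi iota s.
Proof.
elim/tensW: u => s; have [n] := ubnP (size s); elim: n s => // n IH.
case=> [|[m x] s] /= ns gs; first by exists [::].
have [mS|/(separating_functional (absorbed_subspace X (map fst s)))] :=
  pselect (absorbed X (map fst s) m).
  have [t [et e]] := mS x s erefl.
  rewrite tens_cons e in gs *; apply: IH => //.
  by rewrite -(size_map fst) et size_map.
move=> [phi [phim phis]].
have gx : g x = 0.
  move/esym: (gs); rewrite tmap_pi => /tpiP/(contraction_rel phi).
  rewrite big_nil big_cons /= phim rmorph1 scale1r big_map big_seq big1 ?addr0 //.
  move=> w ws; rewrite phis ?rmorph0 ?scale0r //; apply: mem_absorbed.
  exact: map_f.
have [|t [gt et]] := IH s ns.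
  by move: gs; rewrite tens_cons linearD /= tmap_tens /= gx tens0r add0r.
exists ((m, x) :: t); split=> [w|]; last by rewrite !tens_cons et.
by rewrite inE => /orP[/eqP->|/gt].
Qed.

End TensorExact.

(** * Functoriality of the pullback of forms *)

Section PullbackFunctor.
Variable k : fieldType.

Lemma gpull_poly_id p (f : {mpoly k[p.+1]}) : gpull_poly (@idfun 'I_p.+1) f = f.
Proof.
elim/mpoly_gen_ind: f => [f g ef eg|f g ef eg|c|i].
- by rewrite linearD /= ef eg.
- by rewrite rmorphM /= ef eg.
- by rewrite /gpull_poly comp_mpolyC.
- by rewrite /gpull_poly comp_mpolyXU -tnth_nth tnth_mktuple; rewrite (big_pred1 i).
Qed.

Lemma gform_rmorph_ext q (R : nzRingType) (F G : {rmorphism gform k q -> R}) :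
  (forall f, F (gpoly f) = G (gpoly f)) -> (forall i, F (gdt k i) = G (gdt k i)) ->
  F =1 G.
Proof.
move=> ep ed; elim/gform_ind => [a b ea eb|f|i a ea|f a ea].
- by rewrite !rmorphD ea eb.
- exact: ep.
- by rewrite !rmorphM ea ed.
- by rewrite !rmorphM ea ep.
Qed.

Lemma gpull_id p (a : gform k p) : gpull idfun a = a.
Proof.
apply: (@gform_rmorph_ext p _ (gpull idfun) idfun) a => [f|i] /=.
  by rewrite gpull_gpoly gpull_poly_id.
by rewrite gpull_gdt /gpull_dt (big_pred1 i).
Qed.

Section Composition.
Variables (p q r : nat) (alpha : 'I_p.+1 -> 'I_q.+1) (beta : 'I_q.+1 -> 'I_r.+1).

Lemma sum_fiber_comp (V : nmodType) (F : 'I_p.+1 -> V) i :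
  \sum_(j | beta j == i) \sum_(l | alpha l == j) F l
  = \sum_(l | beta (alpha l) == i) F l.
Proof.
rewrite [RHS](partition_big alpha (fun j => beta j == i)) //=.
apply: eq_bigr => j bj; apply: eq_bigl => l.
by case: eqVneq => [->|]; rewrite ?bj ?andbF.
Qed.

Lemma gpull_poly_comp (f : {mpoly k[r.+1]}) :
  gpull_poly alpha (gpull_poly beta f) = gpull_poly (beta \o alpha) f.
Proof.
elim/mpoly_gen_ind: f => [f g ef eg|f g ef eg|c|i].
- by rewrite !linearD /= ef eg.
- by rewrite !rmorphM /= ef eg.
- by rewrite /gpull_poly !comp_mpolyC.
have X s s' (g : 'I_s.+1 -> 'I_s'.+1) l : gpull_poly g ('X_l)
    = \sum_(j | g j == l) 'X_j.
  by rewrite /gpull_poly comp_mpolyXU -tnth_nth tnth_mktuple.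
rewrite !X linear_sum /= -sum_fiber_comp.
by apply: eq_bigr => j _; rewrite X.
Qed.

Lemma gpull_comp (a : gform k r) :
  gpull alpha (gpull beta a) = gpull (beta \o alpha) a.
Proof.
apply: (@gform_rmorph_ext r _ (gpull alpha \o gpull beta)
  (gpull (beta \o alpha))) a => [f|i] /=.
  by rewrite !gpull_gpoly gpull_poly_comp.
rewrite !gpull_gdt linear_sum /gpull_dt /= -sum_fiber_comp.
by apply: eq_bigr => j _; rewrite gpull_gdt.
Qed.

Lemma opull_comp n (w : Omegan k r n) :
  opull alpha (opull beta w) = opull (beta \o alpha) w.
Proof.
apply: Omegan_eq => /=; rewrite -(opi_repr w) !(omap_opi (@gpull_ideal _ _ _ _)).
by rewrite /= gpull_comp.
Qed.

End Composition.

Lemma opull_id p n (w : Omegan k p n) : opull idfun w = w.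
Proof.
apply: Omegan_eq => /=; rewrite -{2}(opi_repr w).
by rewrite /omap; congr opi; apply: gpull_id.
Qed.

End PullbackFunctor.

(** * Multiplication of forms by the barycentric coordinates *)

Lemma omegan_val_sum (k : fieldType) p n (I : finType) (P : pred I)
    (F : I -> Omegan k p n) :
  omegan_val (\sum_(i | P i) F i) = \sum_(i | P i) omegan_val (F i).
Proof. exact: (raddf_sum (val : Omegan k p n -> Omega k p)). Qed.

Section MulT.
Variables (k : fieldType) (p : nat).

Definition gtmul (v : 'I_p.+1) (a : gform k p) : gform k p := gt k v * a.

Fact gtmul_is_linear v : linear (gtmul v).
Proof. by move=> c a b; rewrite /gtmul mulrDr scalerAr. Qed.
HB.instance Definition _ v := GRing.isLinear.Build k (gform k p) (gform k p)
  *:%R (gtmul v) (gtmul_is_linear v).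

Fact gtmul_ideal v a : a \in gideal k p -> gtmul v a \in gideal k p.
Proof. exact: gideal_mull. Qed.

Fact gtmul_homog n v a : a \in ghomog k p n -> gtmul v a \in ghomog k p n.
Proof. exact: ghomogM (gpoly_homog _). Qed.

Definition otmul n (v : 'I_p.+1) : Omegan k p n -> Omegan k p n :=
  omapn (gtmul_ideal v) (@gtmul_homog n v).
HB.instance Definition _ n v := GRing.isLinear.Build k
  (Omegan k p n) (Omegan k p n) *:%R (@otmul n v) (omapn_is_linear _ _).

(** The t_v form a partition of unity, since [gsigma] lies in the ideal. *)
Lemma otmul_sum n (w : Omegan k p n) : \sum_v otmul v w = w.
Proof.
apply: Omegan_eq; rewrite omegan_val_sum /= -[in RHS](opi_repr w).
rewrite -(raddf_sum (@opi k p)) /= -mulr_suml; apply/eqP.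
rewrite opi_eq -[X in _ - X]mul1r -mulrBl.
exact: gideal_mulr (gsigma_in _ _).
Qed.

End MulT.

Lemma opull_otmul (k : fieldType) p q n (alpha : 'I_p.+1 -> 'I_q.+1) v
    (w : Omegan k q n) :
  opull alpha (otmul v w) = \sum_(j | alpha j == v) otmul j (opull alpha w).
Proof.
apply: Omegan_eq; rewrite omegan_val_sum /= -(opi_repr w).
rewrite (omap_opi (gtmul_ideal v)) !(omap_opi (@gpull_ideal _ _ _ _)).
under eq_bigr do rewrite (omap_opi (@gtmul_ideal _ _ _)).
by rewrite -(raddf_sum (@opi k p)) /= rmorphM /= gpull_gt mulr_suml.
Qed.

(** * Cofaces and codegeneracies *)

Definition coface p (i : 'I_p.+2) (j : 'I_p.+1) : 'I_p.+2 := lift i j.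

Fact coface_homo p (i : 'I_p.+2) : {homo coface i : x y / (x <= y)%O >-> (x <= y)%O}.
Proof. by move=> x y; rewrite !leEord /= /bump; lia. Qed.
HB.instance Definition _ p i :=
  Order.isOrderMorphism.Build _ _ _ _ (@coface p i) (@coface_homo p i).

Fact codegeneracy_subproof p (i : 'I_p.+1) (j : 'I_p.+2) : (unbump i j < p.+1)%N.
Proof. by rewrite /unbump; have := ltn_ord i; have := ltn_ord j; lia. Qed.

Definition codegeneracy p (i : 'I_p.+1) (j : 'I_p.+2) : 'I_p.+1 :=
  Ordinal (codegeneracy_subproof i j).

Fact codegeneracy_homo p (i : 'I_p.+1) :
  {homo codegeneracy i : x y / (x <= y)%O >-> (x <= y)%O}.
Proof. by move=> x y; rewrite !leEord /= /unbump; lia. Qed.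
HB.instance Definition _ p i := Order.isOrderMorphism.Build _ _ _ _
  (@codegeneracy p i) (@codegeneracy_homo p i).

Lemma omorphism_eq p q (f g : {omorphism 'I_p.+1 -> 'I_q.+1}) : f =1 g -> f = g.
Proof.
case: f g => [f [[hf]]] [g [[hg]]] /= /funext e; subst g.
by rewrite (Prop_irrelevance hf hg).
Qed.

(** [lift ord0 i] is the vertex i + 1, the larger of the two that [codegeneracy i] identifies. *)
Lemma codegeneracyK p (i : 'I_p.+1) (x : 'I_p.+1) :
  codegeneracy i (coface (lift ord0 i) x) = x.
Proof. by apply: val_inj; rewrite /= /bump /unbump /=; lia. Qed.

(** The coface after [codegeneracy i] moves only i + 1. As j < i, it fixes j and j + 1, which
    [codegeneracy j] identifies, so first sending j + 1 to j changes nothing. *)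
Lemma codegeneracy_swap p (i j : 'I_p.+1) (x : 'I_p.+2) : (j < i)%N ->
  codegeneracy j (coface (lift ord0 i) (codegeneracy i
    (coface (lift ord0 j) (codegeneracy j x))))
  = codegeneracy j (coface (lift ord0 i) (codegeneracy i x)).
Proof.
move=> ji; apply: val_inj; rewrite /= /bump /unbump /=.
by case: (ltnP i x) => ix; case: (ltnP j x) => jx; lia.
Qed.

(** * Simultaneous equations for commuting idempotents *)

Section Filling.
Variables (V : zmodType) (I : eqType) (c : I -> {additive V -> V}) (a : I -> V).
Variables (S : V -> Prop) (s : seq I).
Hypothesis S0 : S 0.
Hypothesis SB : forall u v, S u -> S v -> S (u - v).
Hypothesis Sc : forall i u, S u -> S (c i u).
Hypothesis Sa : forall i, i \in s -> S (a i).
Hypothesis c_idem : forall i u, c i (c i u) = c i u.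
Hypothesis c_comm : forall i j u, c i (c j u) = c j (c i u).
Hypothesis ca_idem : forall i, i \in s -> c i (a i) = a i.
Hypothesis ca_comm : forall i j, i \in s -> j \in s -> c j (a i) = c i (a j).

(** As in filling horns in a simplicial group, indices are treated one by one: [u] becomes
    [u - (c i u - a i)]. An earlier [c j] kills the correction, because
    [c j (c i u) = c i (a j) = c j (a i)]. *)
Lemma commuting_idempotents_filling :
  exists2 u, S u & forall i, i \in s -> c i u = a i.
Proof.
suff h (r : seq I) : {subset r <= s} ->
    exists2 u, S u & forall i, i \in r -> c i u = a i by apply: h.
elim: r => [|i r IH] rs; first by exists 0.
have is_ : i \in s by apply: rs; rewrite mem_head.
have {}rs j : j \in r -> j \in s by move=> jr; apply: rs; rewrite inE jr orbT.
have [u Su cu] := IH rs.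
exists (u - (c i u - a i)); first by do !apply: SB => //; [apply: Sc | apply: Sa].
move=> j; rewrite inE raddfB raddfB /= => /orP[/eqP->|jr].
  by rewrite c_idem ca_idem // subKr.
by rewrite c_comm cu // (ca_comm is_ (rs _ jr)) subrr subr0.
Qed.

End Filling.

(** * Collapsing one vertex of a simplex onto another *)

Section Collapse.
Variable p : nat.
Implicit Types i v x : 'I_p.+2.

Definition collapse v i x := if x == i then v else x.

Lemma collapseC v i j x :
  collapse v i (collapse v j x) = collapse v j (collapse v i x).
Proof.
rewrite /collapse; case: (eqVneq x i) => xi; case: (eqVneq x j) => xj;
  rewrite ?if_same //.
  by rewrite xi eqxx.
by rewrite (negPf xi).
Qed.

Lemma collapseK v i x : collapse v i (collapse v i x) = collapse v i x.
Proof.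
rewrite /collapse; case: (eqVneq x i) => nx; first by case: eqVneq => [->|].
by rewrite (negPf nx).
Qed.

(** For [i != v] the collapse misses the vertex [i], so the default [ord0] is never reached. *)
Definition retraction v i x : 'I_p.+1 := odflt ord0 (unlift i (collapse v i x)).

Lemma coface_retraction v i x : i != v ->
  coface i (retraction v i x) = collapse v i x.
Proof.
move=> niv; have ne : i != collapse v i x.
  by rewrite /collapse; case: (eqVneq x i) => // nx; rewrite eq_sym.
by have [j e1 e2] := unlift_some ne; rewrite /coface /retraction e2 e1.
Qed.

Lemma retraction_coface v i j : i != v -> retraction v i (coface i j) = j.
Proof.
move=> niv; apply: (@lift_inj _ i); rewrite -/(coface i _) coface_retraction //.
by rewrite /collapse /coface eq_sym (negPf (neq_lift _ _)).
Qed.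

End Collapse.

(** * Vertex maps acting on both factors of the tensor product *)

Section Action.
Variables (k : fieldType) (A : comPzRingType) (iota : {rmorphism k -> A}).
Variable n : nat.
Local Notation T X p q := (tensor iota (Omegan k p n) (cs_obj X q)).

Section Biaction.
Variables (X : cosimplicial A) (p p' q q' : nat).
Variables (alpha : 'I_p'.+1 -> 'I_p.+1) (gamma : {omorphism 'I_q.+1 -> 'I_q'.+1}).

(** [alpha] is a plain function, as forms pull back along any map of vertices; [X] is functorial
    only for monotone maps. The indices p and q differ for the defects treated below. *)
Definition biact : T X p q -> T X p' q' := tmap (opull alpha) (cs_map X gamma).
HB.instance Definition _ := GRing.Linear.copy biact
  (tmap (opull alpha) (cs_map X gamma)).
End Biaction.

Section Theory.
Variable X : cosimplicial A.

Lemma biact_comp p p' p'' q q' q'' (alpha : 'I_p'.+1 -> 'I_p.+1)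
    (alpha' : 'I_p''.+1 -> 'I_p'.+1) (gamma : {omorphism 'I_q.+1 -> 'I_q'.+1})
    (gamma' : {omorphism 'I_q'.+1 -> 'I_q''.+1}) (u : T X p q) :
  biact alpha' gamma' (biact alpha gamma u)
  = biact (alpha \o alpha') (gamma' \o gamma) u.
Proof.
rewrite /biact tmap_comp; apply: eq_tmap => [w|x] /=; first by rewrite opull_comp.
by rewrite cs_map_comp.
Qed.

Lemma eq_biact p p' q q' (alpha alpha' : 'I_p'.+1 -> 'I_p.+1)
    (gamma gamma' : {omorphism 'I_q.+1 -> 'I_q'.+1}) (u : T X p q) :
  alpha =1 alpha' -> gamma =1 gamma' -> biact alpha gamma u = biact alpha' gamma' u.
Proof. by move=> /funext -> /omorphism_eq ->. Qed.

Lemma biact_id p q (alpha : 'I_p.+1 -> 'I_p.+1)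
    (gamma : {omorphism 'I_q.+1 -> 'I_q.+1}) (u : T X p q) :
  alpha =1 id -> gamma =1 id -> biact alpha gamma u = u.
Proof.
move=> ea eg; rewrite (@eq_biact _ _ _ _ _ idfun _ idfun) //.
rewrite /biact -[RHS]tmap_id; apply: eq_tmap => [w|x] /=; first exact: opull_id.
exact: cs_map_id.
Qed.

Lemma biactl p p' q (alpha : 'I_p'.+1 -> 'I_p.+1) (u : T X p q) :
  tmap (opull alpha) idfun u = biact alpha idfun u.
Proof. by apply: eq_tmap => // x; rewrite -[LHS](cs_map_id x). Qed.

Lemma biactr p q q' (gamma : {omorphism 'I_q.+1 -> 'I_q'.+1}) (u : T X p q) :
  tmap idfun (cs_map X gamma) u = biact idfun gamma u.
Proof. by apply: eq_tmap => // w; rewrite -[LHS]opull_id. Qed.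

Definition tmul p q (v : 'I_p.+1) : T X p q -> T X p q :=
  tmap (@otmul k p n v) idfun.
HB.instance Definition _ p q v := GRing.Linear.copy (@tmul p q v)
  (tmap (@otmul k p n v) idfun).

Lemma tmul_sum p q (u : T X p q) : \sum_v tmul v u = u.
Proof.
elim/tens_ind: u => [|w x u IH].
  by rewrite big1 // => v _; rewrite linear0.
under eq_bigr do rewrite linearD /=.
rewrite big_split IH /=; congr (_ + _).
under eq_bigr do rewrite [tmul _ _]tmap_tens /=.
rewrite -[in RHS](otmul_sum w).
have h := big_morph (fun m => tens iota m x) (fun m m' => tensDl iota m m' x)
  (tens0l iota _ x).
by rewrite h.
Qed.

Lemma biact_tmul p p' q q' (alpha : 'I_p'.+1 -> 'I_p.+1)
    (gamma : {omorphism 'I_q.+1 -> 'I_q'.+1}) v (u : T X p q) :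
  biact alpha gamma (tmul v u) = \sum_(j | alpha j == v) tmul j (biact alpha gamma u).
Proof.
elim/tens_ind: u => [|w x u IH].
  by rewrite big1 => [|j _]; rewrite !linear0.
rewrite !linearD /= IH; under [RHS]eq_bigr do rewrite !linearD /=.
rewrite big_split /=; congr (_ + _).
rewrite [tmul _ _]tmap_tens [biact _ _ _]tmap_tens /= opull_otmul.
have h := big_morph (fun m => tens iota m (cs_map X gamma x))
  (fun m m' => tensDl iota m m' _) (tens0l iota _ _).
by rewrite h; apply: eq_bigr => j _; rewrite /biact /tmul !tmap_tens.
Qed.

End Theory.

Lemma biact_hom X Y (f : cosimplicial_hom X Y) p p' q q'
    (alpha : 'I_p'.+1 -> 'I_p.+1) (gamma : {omorphism 'I_q.+1 -> 'I_q'.+1})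
    (u : T X p q) :
  tmap idfun (f q') (biact alpha gamma u) = biact alpha gamma (tmap idfun (f q) u).
Proof. by rewrite /biact !tmap_comp; apply: eq_tmap => // x /=; rewrite cs_hom_nat. Qed.

Lemma tmul_hom X Y (f : cosimplicial_hom X Y) p q v (u : T X p q) :
  tmap idfun (f q) (tmul v u) = tmul v (tmap idfun (f q) u).
Proof. by rewrite /tmul !tmap_comp; apply: eq_tmap. Qed.

End Action.

(** * Lifting from level p to level p + 1 *)

Section Step.
Variables (k : fieldType) (A : comPzRingType) (iota : {rmorphism k -> A}).
Variable n : nat.
Local Notation T X p q := (tensor iota (Omegan k p n) (cs_obj X q)).

(* The condition satisfied by the p-th term y_p of a compatible family: as
   (gamma)_* y_p = gamma^* y_s, the element alpha^* gamma_* y_p is the pullback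
   of y_s along gamma o alpha. Only gamma is required to be monotone. *)
Definition coherent (X : cosimplicial A) p (y : T X p p) : Prop :=
  forall r s (alpha alpha' : 'I_r.+1 -> 'I_p.+1)
    (gamma gamma' : {omorphism 'I_p.+1 -> 'I_s.+1}),
  (forall x, gamma (alpha x) = gamma' (alpha' x)) ->
  biact alpha gamma y = biact alpha' gamma' y.

(** Compatibility of consecutive terms along the generating maps between [p] and [p + 1]. *)
Definition extends (X : cosimplicial A) p (y : T X p p) (y' : T X p.+1 p.+1) :=
  (forall i, biact (coface i) idfun y' = biact idfun (coface i) y) /\
  (forall i, biact idfun (codegeneracy i) y' = biact (codegeneracy i) idfun y).

Variables (Y Z : cosimplicial A) (g : cosimplicial_hom Y Z).
Variables (p : nat) (y : T Y p p) (y0 : T Y p.+1 p.+1).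
Hypothesis y_coh : coherent y.
Hypothesis g_ext : extends (tmap idfun (g p) y) (tmap idfun (g p.+1) y0).

(** The conditions are imposed one at a time by adding the coface image of the current defect. This
    defect vanishes in [Z], where the conditions already hold. *)
Lemma codegeneracy_correction : exists2 w : T Y p.+1 p.+1,
  tmap idfun (g p.+1) w = tmap idfun (g p.+1) y0 &
  forall i, biact idfun (codegeneracy i) w = biact (codegeneracy i) idfun y.
Proof.
suff h m : (m <= p.+1)%N -> exists2 w : T Y p.+1 p.+1,
    tmap idfun (g p.+1) w = tmap idfun (g p.+1) y0 &
    forall i : 'I_p.+1, (i < m)%N ->
      biact idfun (codegeneracy i) w = biact (codegeneracy i) idfun y.
  by have [w gw hw] := h _ (leqnn _); exists w => // i; apply: hw.
elim: m => [|m IH] hm; first by exists y0.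
have [w gw hw] := IH (ltnW hm); pose i := Ordinal hm.
pose s : {omorphism 'I_p.+2 -> 'I_p.+1} := codegeneracy i.
pose d : {omorphism 'I_p.+1 -> 'I_p.+2} := coface (lift ord0 i).
exists (w + biact idfun d (biact s idfun y - biact idfun s w)).
  rewrite linearD /= gw biact_hom linearB /= !biact_hom gw.
  by rewrite (g_ext.2 i) subrr linear0 addr0.
move=> j; rewrite ltnS leq_eqVlt linearD /= => /orP[/eqP ej|ji].
  have {ej} -> : j = i by apply: val_inj.
  have dK u : biact idfun s (biact idfun d u) = u.
    by rewrite biact_comp; apply: biact_id => // x; apply: codegeneracyK.
  by rewrite dK addrC subrK.
rewrite hw // [X in _ + X](_ : _ = 0) ?addr0 //.
rewrite !linearB; apply/eqP; rewrite subr_eq0; apply/eqP => /=.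
pose sj : {omorphism 'I_p.+2 -> 'I_p.+1} := codegeneracy j.
pose dj : {omorphism 'I_p.+1 -> 'I_p.+2} := coface (lift ord0 j).
(* [th] is the factor in s_j d s_i = th s_j: the known value of [sj] on [w] thus determines its
   value on the correction. *)
pose th : {omorphism 'I_p.+1 -> 'I_p.+1} := sj \o (d \o (s \o dj)).
have thE x : th (sj x) = sj (d (s x)) by apply: codegeneracy_swap.
have -> : biact idfun sj (biact idfun d (biact idfun s w))
    = biact idfun th (biact idfun sj w).
  by rewrite !biact_comp; apply: eq_biact => // x; rewrite /= -thE.
rewrite hw // !biact_comp; apply: y_coh => x /=.
by rewrite -thE.
Qed.

Lemma coherent_step : exists2 w : T Y p.+1 p.+1,
  tmap idfun (g p.+1) w = tmap idfun (g p.+1) y0 & extends y w.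
Proof.
have [w gw sw] := codegeneracy_correction.
pose d (i : 'I_p.+2) : {omorphism 'I_p.+1 -> 'I_p.+2} := coface i.
pose s (i : 'I_p.+1) : {omorphism 'I_p.+2 -> 'I_p.+1} := codegeneracy i.
pose a i : T Y p p.+1 := biact idfun (d i) y - biact (d i) idfun w.
pose S q (u : T Y q p.+1) :=
  tmap idfun (g p.+1) u = 0 /\ forall j, biact idfun (s j) u = 0.
have Sa i : S p (a i).
  split=> [|j]; first by rewrite linearB /= !biact_hom gw (g_ext.1 i) subrr.
  rewrite linearB /= !biact_comp; apply/eqP; rewrite subr_eq0; apply/eqP.
  (* s_j d_i is an endomorphism of [p], and by coherence it may act on either factor of [y]. *)
  transitivity (biact (d i) idfun (biact idfun (s j) w)); last first.
    by rewrite biact_comp; apply: eq_biact.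
  by rewrite sw biact_comp; apply: y_coh.
have Sact q q' (al : 'I_q'.+1 -> 'I_q.+1) u : S q u -> S q' (biact al idfun u).
  case=> gu su; split=> [|j]; first by rewrite biact_hom gu linear0.
  transitivity (biact al idfun (biact idfun (s j) u)); last by rewrite su linear0.
  by rewrite !biact_comp; apply: eq_biact.
(* [b i] is the defect on the face [i], pulled back along the retraction onto
   that face which sends the vertex [i] to [v]. *)
have fill v : exists u, S p.+1 u /\
    forall i, i != v -> biact (d i) idfun u = a i.
  pose c i : {additive T Y p.+1 p.+1 -> T Y p.+1 p.+1} :=
    biact (collapse v i) (idfun : {omorphism _ -> _}).
  pose b i : T Y p.+1 p.+1 := biact (retraction v i) idfun (a i).
  have bE i : b i = biact (retraction v i) (d i) y
      - biact (d i \o retraction v i) idfun w.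
    by rewrite /b linearB /= !biact_comp; congr (_ - _); apply: eq_biact.
  pose r := [seq i <- enum 'I_p.+2 | i != v].
  have mem_r i : (i \in r) = (i != v) by rewrite mem_filter mem_enum andbT.
  case: (@commuting_idempotents_filling _ _ c b (S p.+1) r).
  - by split=> *; rewrite linear0.
  - move=> u u' [gu su] [gu' su']; split=> [|j]; rewrite linearB /=.
      by rewrite gu gu' subrr.
    by rewrite su su' subrr.
  - by move=> i u; apply: Sact.
  - by move=> i _; apply: Sact.
  - move=> i u; rewrite /c /= !biact_comp; apply: eq_biact => // x.
    exact: collapseK.
  - move=> i j u; rewrite /c /= !biact_comp; apply: eq_biact => // x.
    exact: collapseC.
  - move=> i; rewrite mem_r => niv; rewrite /c /b /= biact_comp; apply: eq_biact => // x.
    apply: (@lift_inj _ i); rewrite -![lift _ _]/(coface _ _) /=.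
    by rewrite !coface_retraction // collapseK.
  (* On [y] only the composite vertex map counts, by coherence. For [y] and [w] alike it is the
     composite of two collapses, which commute. *)
  - move=> i j; rewrite !mem_r => niv njv; rewrite !bE !raddfB /c /= !biact_comp.
    congr (_ - _).
      by apply: y_coh => x /=; rewrite !coface_retraction // collapseC.
    by apply: eq_biact => // x /=; rewrite !coface_retraction // collapseC.
  move=> u Su cu; exists u; split=> // i niv.
  (* Restrict [c i u = b i] to the face [i], which the collapse fixes pointwise and on which the
     retraction is the identity. *)
  have := congr1 (biact (d i) idfun) (cu i _); rewrite mem_r niv => /(_ isT).
  rewrite /c /b /= !biact_comp => e.
  transitivity (biact (collapse v i \o d i) (idfun \o idfun) u).
    apply: eq_biact => // x.
    by rewrite /= /collapse /coface eq_sym (negPf (neq_lift _ _)).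
  rewrite e; apply: biact_id => // x /=.
  exact: retraction_coface.
have [F hF] := choice fill.
exists (w + \sum_v tmul v (F v)).
  rewrite linearD linear_sum /= big1 ?addr0 // => v _.
  by rewrite tmul_hom (hF v).1.1 linear0.
split=> i; rewrite linearD linear_sum /=; last first.
  rewrite sw big1 ?addr0 // => v _; rewrite biact_tmul (hF v).1.2.
  by rewrite big1 // => j _; rewrite linear0.
suff -> : \sum_v biact (coface i) idfun (tmul v (F v)) = a i by rewrite addrC subrK.
(* t_v restricts to the sum of the t_j with d_i j = v, so only the [F v] with [v != i] survive. *)
transitivity (\sum_j tmul j (biact (d i) idfun (F (d i j)))).
  rewrite [RHS](partition_big (d i) predT) //=; apply: eq_bigr => v _.
  by rewrite biact_tmul; apply: eq_bigr => j /eqP ->.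
rewrite -[RHS]tmul_sum; apply: eq_bigr => j _.
by rewrite (hF _).2 //; apply: neq_lift.
Qed.

End Step.

(** * Rigidity of monotone maps between finite ordinals *)

Lemma omorphism_le p q (f : {omorphism 'I_p.+1 -> 'I_q.+1}) (i j : 'I_p.+1) :
  (i <= j)%N -> (f i <= f j)%N.
Proof. exact: (Order.OrderMorphismTheory.omorph_le f). Qed.

Lemma omorphism_reflect_lt p q (f : {omorphism 'I_p.+1 -> 'I_q.+1}) (i j : 'I_p.+1) :
  (f i < f j)%N -> (i < j)%N.
Proof.
by rewrite !ltnNge; apply: contra; apply: omorphism_le.
Qed.

Lemma omorphism_inj_lt p q (f : {omorphism 'I_p.+1 -> 'I_q.+1}) (i j : 'I_p.+1) :
  injective f -> (i < j)%N -> (f i < f j)%N.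
Proof.
move=> f_inj ij; rewrite ltn_neqAle (_ : f i <= f j)%N ?andbT; last first.
  by apply: omorphism_le; apply: ltnW.
by apply: contraTneq ij => /val_inj/f_inj->; rewrite ltnn.
Qed.

Lemma strictly_increasing_ge n (f : 'I_n -> 'I_n) :
  (forall i j : 'I_n, (i < j)%N -> (f i < f j)%N) -> forall i : 'I_n, (i <= f i)%N.
Proof.
move=> fS [m hm] /=; elim: m hm => // m IH hm.
by apply: leq_ltn_trans (IH (ltnW hm)) _; apply: fS.
Qed.

(** [h] is strictly increasing because [f' \o h] is, so i <= h i; now apply [f']. Used in both
    directions, it shows that two monotone injections factoring through each other coincide. *)
Lemma omorphism_factor_le p q (f f' : {omorphism 'I_p.+1 -> 'I_q.+1})
    (h : 'I_p.+1 -> 'I_p.+1) :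
  injective f -> (forall i, f' (h i) = f i) -> forall i, (f' i <= f i)%N.
Proof.
move=> f_inj e i; rewrite -e; apply: omorphism_le.
apply: strictly_increasing_ge => a b ab; apply: (@omorphism_reflect_lt _ _ f').
by rewrite !e; apply: omorphism_inj_lt.
Qed.

(** * Coherent elements and compatible families *)

Section Coherence.
Variables (k : fieldType) (A : comPzRingType) (iota : {rmorphism k -> A}).
Variables (n : nat) (X : cosimplicial A).
Local Notation T p q := (tensor iota (Omegan k p n) (cs_obj X q)).

Lemma coherent0 (y : T 0 0) : coherent y.
Proof.
move=> r s al al' ga ga' e; apply: eq_biact => i; first by rewrite !ord1.
by have := e ord0; rewrite !(ord1 (al _)) !(ord1 (al' _)) (ord1 i).
Qed.

Section Extension.
Variables (p : nat) (y : T p p) (w : T p.+1 p.+1).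
Hypothesis yw : extends y w.

(** If [al] misses a vertex it factors through a coface; if [ga] is not injective it factors through
    a codegeneracy. [extends] moves this factor across the tensor product, turning [w] into [y]. *)
Lemma extends_reduce r s (al : 'I_r.+1 -> 'I_p.+2)
    (ga : {omorphism 'I_p.+2 -> 'I_s.+1}) :
  (exists i, forall x, i != al x) \/ ~ injective ga ->
  exists (al1 : 'I_r.+1 -> 'I_p.+1) (ga1 : {omorphism 'I_p.+1 -> 'I_s.+1}),
    (forall x, ga1 (al1 x) = ga (al x)) /\ biact al ga w = biact al1 ga1 y.
Proof.
case=> [[i nal]|ninj].
  pose d : {omorphism 'I_p.+1 -> 'I_p.+2} := coface i.
  pose al1 x := odflt ord0 (unlift i (al x)).
  have dal x : d (al1 x) = al x.
    by have [j e1 e2] := unlift_some (nal x); rewrite /al1 e2 e1.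
  exists al1, (ga \o d); split=> [x|]; first by rewrite /= dal.
  transitivity (biact al1 ga (biact d idfun w)).
    by rewrite biact_comp; apply: eq_biact => x //=; rewrite dal.
  by rewrite yw.1 biact_comp; apply: eq_biact.
have [a [b [ab gab]]] : exists a b : 'I_p.+2, (a < b)%N /\ ga a = ga b.
  apply: contrapT => h; apply: ninj => a b gab; apply/val_inj/eqP.
  rewrite eqn_leq; apply/andP; split; rewrite leqNgt; apply/negP => ab; apply: h.
    by exists b, a.
  by exists a, b.
have ap : (a < p.+1)%N by apply: leq_trans ab _; rewrite -ltnS.
pose i := Ordinal ap; pose s_ : {omorphism 'I_p.+2 -> 'I_p.+1} := codegeneracy i.
pose d : {omorphism 'I_p.+1 -> 'I_p.+2} := coface (lift ord0 i).
(* [d] after [s_] moves only a + 1, to a. As a < a + 1 <= b and [ga] is monotone, [ga] agrees on a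
   and a + 1. *)
have gads x : ga (d (s_ x)) = ga x.
  have [xi|xi] := eqVneq (x : nat) a.+1; last first.
    congr (ga _); apply: val_inj; move: xi; rewrite /= /bump /unbump /=.
    by case: (ltnP a x); lia.
  have -> : d (s_ x) = a.
    by apply: val_inj; rewrite /= /bump /unbump /= xi; lia.
  apply: val_inj; apply/eqP; rewrite eqn_leq; apply/andP; split.
    by apply: omorphism_le; rewrite xi.
  by rewrite gab; apply: omorphism_le; rewrite xi.
exists (s_ \o al), (ga \o d); split=> [x|]; first by rewrite /= gads.
transitivity (biact al (ga \o d) (biact idfun s_ w)).
  by rewrite biact_comp; apply: eq_biact => x //=; rewrite gads.
by rewrite yw.2 biact_comp; apply: eq_biact.
Qed.

Lemma irreducible_section r s (al : 'I_r.+1 -> 'I_p.+2)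
    (ga : {omorphism 'I_p.+2 -> 'I_s.+1}) :
  ~ ((exists i, forall x, i != al x) \/ ~ injective ga) ->
  injective ga /\ exists t, forall i, al (t i) = i.
Proof.
move=> h; split; first by apply: contrapT => ni; apply: h; right.
suff /choice[t alt] : forall i, exists x, al x = i by exists t.
move=> i; apply: contrapT => ni; apply: h; left; exists i => x.
by apply/eqP => e; apply: ni; exists x.
Qed.

(** Composed with the section [t], such a factorization would inject p + 2 vertices into p + 1. *)
Lemma irreducible_not_factor r s (al : 'I_r.+1 -> 'I_p.+2)
    (ga : {omorphism 'I_p.+2 -> 'I_s.+1}) (al1 : 'I_r.+1 -> 'I_p.+1)
    (ga1 : 'I_p.+1 -> 'I_s.+1) :
  injective ga -> (exists t, forall i, al (t i) = i) ->
  ~ (forall x, ga1 (al1 x) = ga (al x)).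
Proof.
move=> ga_inj [t alt] e; have : injective (al1 \o t).
  by move=> i j /= /(congr1 ga1); rewrite !e !alt => /ga_inj.
by move=> /leq_card; rewrite !card_ord ltnn.
Qed.

(* A composite gamma o alpha with alpha onto and gamma injective determines both
   maps; every other composite factors through [p]. *)
Lemma coherent_extends : coherent y -> coherent w.
Proof.
move=> cy r s al al' ga ga' e.
have [red|/irreducible_section[ga_inj al_sec]] :=
    pselect ((exists i, forall x, i != al x) \/ ~ injective ga);
  have [red'|/irreducible_section[ga'_inj al'_sec]] :=
    pselect ((exists i, forall x, i != al' x) \/ ~ injective ga').
- have [al1 [ga1 [e1 ->]]] := extends_reduce red.
  have [al2 [ga2 [e2 ->]]] := extends_reduce red'.
  by apply: cy => x; rewrite e1 e2 e.
- have [al1 [ga1 [e1 _]]] := extends_reduce red.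
  case: (irreducible_not_factor ga'_inj al'_sec (al1 := al1) (ga1 := ga1)).
  by move=> x; rewrite e1 e.
- have [al1 [ga1 [e1 _]]] := extends_reduce red'.
  case: (irreducible_not_factor ga_inj al_sec (al1 := al1) (ga1 := ga1)).
  by move=> x; rewrite e1 e.
have [t alt] := al_sec; have [t' al't] := al'_sec.
have ega : ga =1 ga'.
  move=> i; apply: val_inj; apply/eqP; rewrite eqn_leq.
  rewrite (@omorphism_factor_le _ _ ga' ga (al \o t')) //.
    rewrite (@omorphism_factor_le _ _ ga ga' (al' \o t)) //.
    by move=> j /=; rewrite -e alt.
  by move=> j /=; rewrite e al't.
by apply: eq_biact => // x; apply: ga'_inj; rewrite -e ega.
Qed.

End Extension.

Section Sequence.
Variable y : forall p, T p p.
Hypothesis y_coh : forall p, coherent (y p).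
Hypothesis y_ext : forall p, extends (y p) (y p.+1).

(** Since s d = id, the codegeneracy condition s_* y_(N+1) = s^* y_N gives y_N = d^* s_* y_(N+1).
    Any two terms are thus expressed through one later term, where coherence compares them. *)
Lemma retract_of_later p N : (p <= N)%N ->
  exists (f : {omorphism 'I_p.+1 -> 'I_N.+1}) (h : {omorphism 'I_N.+1 -> 'I_p.+1}),
    (forall x, h (f x) = x) /\ y p = biact f h (y N).
Proof.
elim: N => [|N IH].
  by rewrite leqn0 => /eqP ->; exists idfun, idfun; split=> //; rewrite biact_id.
rewrite leq_eqVlt => /orP[/eqP ->|pN].
  by exists idfun, idfun; split=> //; rewrite biact_id.
have [f [h [hf ->]]] := IH pN.
pose s : {omorphism 'I_N.+2 -> 'I_N.+1} := codegeneracy ord0.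
pose d : {omorphism 'I_N.+1 -> 'I_N.+2} := coface (lift ord0 ord0).
exists (d \o f), (h \o s); split=> [x|].
  by rewrite /= [codegeneracy _ _]codegeneracyK hf.
have -> : y N = biact d s (y N.+1).
  transitivity (biact d idfun (biact idfun s (y N.+1))).
    rewrite (y_ext N).2 biact_comp biact_id // => x.
    exact: codegeneracyK.
  by rewrite biact_comp; apply: eq_biact.
by rewrite biact_comp.
Qed.

Lemma sequence_compatible : ts_compatible y.
Proof.
move=> p q al; rewrite biactl biactr.
have [f [h [hf ->]]] := retract_of_later (leq_addr q p).
have [f' [h' [hf' ->]]] := retract_of_later (leq_addl p q).
rewrite !biact_comp; apply: y_coh => x /=.
by rewrite hf hf'.
Qed.

End Sequence.
End Coherence.

(** * Exactness of the functor *)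

Section Exactness.
Variables (k : fieldType) (A : comPzRingType) (iota : {rmorphism k -> A}).
Variables (X Y : cosimplicial A).

Lemma ts_map_surj (f : cosimplicial_hom X Y) n :
  (forall p y, exists x, f p x = y) ->
  forall z : thom_sullivan_module iota Y n, exists x, ts_map f x = z.
Proof.
move=> f_surj z.
have tf_surj p q (u : tensor iota (Omegan k p n) (Y q)) :
    exists v, tmap idfun (f q) v = u.
  elim/tens_ind: u => [|m y u [v ev]]; first by exists 0; rewrite linear0.
  have [x ex] := f_surj q y; exists (tens iota m x + v).
  by rewrite linearD /= tmap_tens /= ex ev.
have z_ext p : extends (z p) (z p.+1).
  by split=> i; rewrite -biactl -biactr ts_compat.
(* Coherence is stored with each lift, as the next step requires it; the sequence is then built by
   dependent choice. *)
pose St p := {u : tensor iota (Omegan k p n) (X p) |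
  tmap idfun (f p) u = z p /\ coherent u}.
have step p (u : St p) : {v : St p.+1 | extends (sval u) (sval v)}.
  apply: cid; case: u => u [fu cu] /=; have [v0 fv0] := tf_surj _ _ (z p.+1).
  have [|v fv ev] := @coherent_step _ _ iota n X Y f p u v0 cu.
    by rewrite fu fv0.
  have Pv : tmap idfun (f p.+1) v = z p.+1 /\ coherent v.
    by rewrite fv fv0; split=> //; apply: coherent_extends ev cu.
  by exists (exist _ v Pv).
have [u0 fu0] := cid (tf_surj _ _ (z 0)).
pose s := nat_rect St (exist _ u0 (conj fu0 (coherent0 u0)))
  (fun p u => sval (step p u)).
have s_ext p : extends (sval (s p)) (sval (s p.+1)) by apply: (svalP (step p (s p))).
have sc := sequence_compatible (fun p => (svalP (s p)).2) s_ext.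
by exists (ThomSullivanModule sc); apply: ts_ext => p /=; case: (svalP (s p)).
Qed.

End Exactness.

(** By [tmap_ker] a kernel element is a sum of pure tensors whose right factors are killed by [f],
    hence zero. *)
Lemma tmap_inj (k : fieldType) (A : comPzRingType) (iota : {rmorphism k -> A})
    (M : lmodType k) (X Y : lmodType A) (f : {linear X -> Y}) :
  injective f ->
  injective (tmap idfun f : tensor iota M X -> tensor iota M Y).
Proof.
move=> f_inj u v /eqP; rewrite -subr_eq0 -linearB /= => /eqP/tmap_ker[s [fs e]].
apply/eqP; rewrite -subr_eq0 e; apply/eqP; elim: s fs {e} => // -[m x] s IH fs.
rewrite tens_cons IH ?addr0 => [|w ws]; last by apply: fs; rewrite inE ws orbT.
have x0 : x = 0.
  by apply: f_inj; rewrite linear0; apply: (fs (m, x)); rewrite mem_head.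
by rewrite x0 tens0r.
Qed.

(** [tmap_ker] gives right factors killed by [g], which are lifted along [f] term by term. *)
Lemma tmap_exact (k : fieldType) (A : comPzRingType) (iota : {rmorphism k -> A})
    (M : lmodType k) (X Y Z : lmodType A) (f : {linear X -> Y})
    (g : {linear Y -> Z}) :
  (forall y, g y = 0 <-> exists x, f x = y) ->
  forall v : tensor iota M Y,
    tmap idfun g v = 0 <-> exists u : tensor iota M X, tmap idfun f u = v.
Proof.
move=> fg v; split=> [/tmap_ker[s [gs ->]]|[u <-]]; last first.
  rewrite tmap_comp; elim/tens_ind: u => [|m x u IH]; first by rewrite linear0.
  rewrite linearD /= IH addr0 tmap_tens /= (_ : g (f x) = 0) ?tens0r //.
  by apply/fg; exists x.
elim: s gs => [|[m y] s IH] gs; first by exists 0; rewrite linear0.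
have [w ws|u eu] := IH; first by apply: gs; rewrite inE ws orbT.
have /fg[x ex] : g y = 0 by apply: (gs (m, y)); rewrite mem_head.
by exists (tens iota m x + u); rewrite linearD /= tmap_tens /= ex eu tens_cons.
Qed.

Theorem corollary6p12 (k : fieldType) (char0 : [pchar k] =i pred0)
    (A : comPzRingType) (iota : {rmorphism k -> A}) :
  exact_functor (thom_sullivan iota).
Proof.
move=> X Y Z f g fg n; split=> [u v /(congr1 (@ts_val _ _ _ _ _)) e|v|w].
- apply: ts_ext => p; have [f_inj _ _] := fg p.
  exact: tmap_inj f_inj _ _ (congr1 (fun h => h p) e).
- have ex p := let: And3 _ h _ := fg p in tmap_exact h (ts_val v p).
  split=> [gv|[u <-]]; last first.
    by apply: ts_ext => p; apply/tmap_exact; [case: (fg p) | exists (ts_val u p)].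
  have {}ex p : {u | tmap idfun (f p) u = ts_val v p}.
    by apply: cid; apply/ex; apply: (congr1 (fun h => ts_val h p) gv).
  (* The preimages are chosen separately for each p; they are compatible because their images are
     and tensoring keeps [f] injective. *)
  have uc : ts_compatible (fun p => sval (ex p)).
    move=> p q al; have [f_inj _ _] := fg q; apply: (tmap_inj f_inj).
    rewrite biactl biactr !biact_hom (svalP (ex p)) (svalP (ex q)) -biactl -biactr.
    exact: ts_compat.
  by exists (ThomSullivanModule uc); apply: ts_ext => p; apply: svalP (ex p).
by apply: (ts_map_surj (f := g)) => p; case: (fg p).
Qed.
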